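(* For every fixed constant $n\ge 2$, the decision problem \textsc{Optimal Transfers}, restricted to instances with exactly $n$ agents having binary utilities, is in P.
   Context: Let $N=\{1,\dots,n\}$ be a set of $n\ge 2$ agents and $M$ a set of $m\ge 1$ indivisible goods. Each agent $i$ has an additive utility function $u_i:2^M\to\mathbb{R}_{\ge 0}$, i.e., $u_i(M')=\sum_{g\in M'}u_i(\{g\})$. An instance consists of $N$, $M$ and $(u_i)_{i\in N}$. Utilities are binary if $u_i(\{g\})\in\{0,1\}$ for all $i\in N$, $g\in M$. An allocation $\mathcal{A}=(A_1,\dots,A_n)$ is an ordered partition of $M$ into $n$ (possibly empty) bundles, $A_i$ going to agent $i$. Agent $i$ is EF1 towards agent $j$ in $\mathcal{A}$ if $A_j=\varnothing$ or there exists $g\in A_j$ with $u_i(A_i)\ge u_i(A_j\setminus\{g\})$. $\mathcal{A}$ is EF1 if every agent is EF1 towards every other agent. A transfer moves a single good from one agent's bundle to another agent's bundle, leaving everything else unchanged. The optimal number of transfers required to reach an EF1 allocation from $\mathcal{A}$ is the smallest $T\ge 0$ such that some sequence of $T$ transfers starting at $\mathcal{A}$ ends in an EF1 allocation. \textsc{Optimal Transfers}: given an instance (utilities listed good by good for each agent), an initial allocation $\mathcal{A}$, and a number $k$, decide whether the optimal number of transfers required to reach an EF1 allocation from $\mathcal{A}$ is at most $k$. *)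

(* Defs.v *)
From HB Require Import structures.
From mathcomp Require Import all_boot all_order all_algebra.
From mathcomp Require Import reals.

Set Implicit Arguments.
Unset Strict Implicit.
Unset Printing Implicit Defensive.

Import Order.TTheory GRing.Theory Num.Theory.

Inductive move := MoveLeft | Stay | MoveRight.

(* A machine over the input alphabet Sigma has ntapes.+1 tapes, tape 0 being  *)
(* the input tape.  A cell holds None (blank), Some (inl a) with a an input   *)
(* symbol, or Some (inr b) with b an auxiliary symbol.  As states and symbols *)
(* form finite types, the transition function is a finite table.              *)
Record turing_machine (Sigma : finType) := TuringMachine {
  ntapes : nat;
  state : finType;
  work : finType;
  start : state;
  (* None: still running; Some b: halted, with answer b *)
  verdict : state -> option bool;
  delta : state -> {ffun 'I_ntapes.+1 -> option (Sigma + work)} ->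
          state * {ffun 'I_ntapes.+1 -> option (Sigma + work) * move}
}.

(* A two-way infinite tape, blank outside finitely many cells: tape_left      *)
(* lists the cells to the left of the head, nearest first, and tape_right the *)
(* scanned cell and those to its right; cells beyond the lists are blank.     *)
Record tape (S : Type) := Tape {
  tape_left : seq (option S);
  tape_right : seq (option S)
}.

Definition tape_read (S : Type) (t : tape S) : option S :=
  head None (tape_right t).

Definition tape_act (S : Type) (t : tape S) (am : option S * move) : tape S :=
  let l := tape_left t in
  let r := behead (tape_right t) in
  match am.2 with
  | MoveLeft => Tape (behead l) (head None l :: am.1 :: r)
  | Stay => Tape l (am.1 :: r)
  | MoveRight => Tape (am.1 :: l) r
  end.

Record config (Sigma : finType) (M : turing_machine Sigma) := Config {
  cstate : state M;
  ctapes : {ffun 'I_(ntapes M).+1 -> tape (Sigma + work M)}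
}.

Definition init (Sigma : finType) (M : turing_machine Sigma) (w : seq Sigma) :
    config M :=
  Config (start M)
    [ffun i => Tape [::] (if i == ord0 then [seq Some (inl a) | a <- w]
                          else [::])].

Definition step (Sigma : finType) (M : turing_machine Sigma) (c : config M) :
    config M :=
  if verdict (cstate c) is Some _ then c else
  let d := delta (cstate c) [ffun i => tape_read (ctapes c i)] in
  Config d.1 [ffun i => tape_act (ctapes c i) (d.2 i)].

Definition language (Sigma : finType) := seq Sigma -> Prop.

(* step is the identity on halted configurations, so the verdict after t      *)
(* steps is the answer of the machine, and t bounds its running time.         *)
Definition in_P (Sigma : finType) (L : language Sigma) : Prop :=
  exists (M : turing_machine Sigma) (p : {poly nat}),
    forall w : seq Sigma, exists (t : nat) (b : bool),
      [/\ t <= p.[size w]%R,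
          verdict (cstate (iter t (@step Sigma M) (init M w))) = Some b
        & b <-> L w].

Record instance (R : realType) := Instance {
  agents : nat;
  goods : nat;
  agents_ge2 : 2 <= agents;
  goods_ge1 : 1 <= goods;
  util : 'I_agents -> {set 'I_goods} -> R;
  util_ge0 : forall i S, (0 <= util i S)%R;
  util_additive : forall i S, util i S = (\sum_(g in S) util i [set g])%R
}.

Definition binary_utilities (R : realType) (I : instance R) : Prop :=
  forall (i : 'I_(agents I)) (g : 'I_(goods I)),
    util i [set g] = 0%R \/ util i [set g] = 1%R.

Definition bundles (R : realType) (I : instance R) :=
  {ffun 'I_(agents I) -> {set 'I_(goods I)}}.

Definition is_allocation (R : realType) (I : instance R) (A : bundles I) :
    Prop :=
  (forall i j, i != j -> [disjoint A i & A j]) /\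
  (\bigcup_i A i = [set: 'I_(goods I)])%SET.

Definition EF1_towards (R : realType) (I : instance R) (A : bundles I)
    (i j : 'I_(agents I)) : Prop :=
  A j = set0 \/ exists2 g, g \in A j & (util i (A j :\ g) <= util i (A i))%R.

Definition EF1 (R : realType) (I : instance R) (A : bundles I) : Prop :=
  forall i j, i != j -> EF1_towards A i j.

Definition transfer (R : realType) (I : instance R) (A B : bundles I) : Prop :=
  exists (i j : 'I_(agents I)) (g : 'I_(goods I)),
    [/\ i != j, g \in A i
      & B = [ffun h => if h == i then A i :\ g
                       else if h == j then g |: A j else A h]].

Fixpoint reachable_in (R : realType) (I : instance R) (T : nat)
    (A B : bundles I) : Prop :=
  if T is T'.+1 then exists2 C, transfer A C & reachable_in T' C B else A = B.

Definition EF1_reachable_in (R : realType) (I : instance R) (A : bundles I)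
    (T : nat) : Prop :=
  exists2 B, reachable_in T A B & EF1 B.

Definition optimal_number_of_transfers (R : realType) (I : instance R)
    (A : bundles I) (T : nat) : Prop :=
  EF1_reachable_in A T /\ forall T', EF1_reachable_in A T' -> T <= T'.

Definition optimal_transfers (R : realType) (I : instance R) (A : bundles I)
    (k : nat) : Prop :=
  exists2 T, optimal_number_of_transfers A T & T <= k.

(* Strings are over the alphabet {0, 1, #}: Some false, Some true and None.   *)
Definition symbol : finType := option bool.

Definition row (s : seq bool) : seq symbol := rcons [seq Some b | b <- s] None.

(* Binary expansion, most significant digit first, without leading zeros; the *)
(* expansion of 0 is the single digit 0.                                      *)
Definition binary (k : nat) : seq bool :=
  [seq odd (k %/ 2 ^ i) | i <- rev (iota 0 (trunc_log 2 k).+1)].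

(* One row per agent listing its utility for each good, then one row per      *)
(* agent giving the indicator vector of its bundle, then k in binary.  Each   *)
(* utility takes one digit, so this is meant for binary utilities only.       *)
Definition encode (R : realType) (I : instance R) (A : bundles I) (k : nat) :
    seq symbol :=
  flatten [seq row [seq util i [set g] == 1%R | g <- enum 'I_(goods I)]
          | i <- enum 'I_(agents I)] ++
  flatten [seq row [seq g \in A i | g <- enum 'I_(goods I)]
          | i <- enum 'I_(agents I)] ++
  [seq Some b | b <- binary k].

Definition binary_optimal_transfers (R : realType) (n : nat) :
    language symbol :=
  fun w => exists (I : instance R) (A : bundles I) (k : nat),
    [/\ agents I = n /\ binary_utilities I, is_allocation A,
        w = encode A k & optimal_transfers A k].

(* Main.v *)
Require Import Defs.
From mathcomp Require Import all_boot all_order all_algebra.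
From mathcomp Require Import reals.
From mathcomp Require Import boolp zify.
Import Defs.
Import Order.TTheory GRing.Theory Num.Theory.

Set Implicit Arguments.
Unset Strict Implicit.
Unset Printing Implicit Defensive.

(* With binary utilities, an allocation is EF1 iff u_i(A_j) <= u_i(A_i) + 1   *)
(* for all i and j, and the optimal number of transfers is the least Hamming  *)
(* distance to an EF1 allocation.  Both only depend on the numbers x(k, j) of *)
(* goods of class k (utility vector and initial owner) that end up with j,    *)
(* and for fixed n there are polynomially many such vectors x.  They can be   *)
(* enumerated by a deterministic two-way automaton with a constant number of  *)
(* heads on the input: each x(k, j) is a head position, and a vector is       *)
(* tested by scanning the goods, giving each one to the first agent j with    *)
(* x(k, j) > 0 left.  A halting run of such an automaton never repeats a      *)
(* configuration, so it takes polynomially many steps, and a Turing machine   *)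
(* with one copy of the input per head simulates it step by step.             *)

(** * Multi-head automata and their simulation by Turing machines *)

(** Describe an allocation by its owner function. A transfer changes one value of it, so the optimal
    number of transfers is the least Hamming distance [moved f h] to an EF1 target [h]
    ([optimal_transfersP]). With binary utilities EF1 is a family of inequalities between counts of
    goods ([EF1_ownedP]). An instance with a target is therefore a word [z] over the finite alphabet
    [good_move n], one letter (utilities, old owner, new owner) per good. Fairness and cost depend
    only on how often each letter occurs. [solution w z] is this certificate, free of real numbers,
    and [solutionP] ties it to the language.

    For fixed [n] the letter counts x form a constant number of counters bounded by the input
    length, so all of them can be tried. Given x, a greedy scan of the goods builds some [z] within
    the budget x ([assign_columnsP]). If a solution has exactly the counts x, the greedy word is a
    permutation of it and passes the same tests. This makes one attempt sound and complete
    ([runs_attempt]), and [decide_solution] loops over all x.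

    The counters are heads of an automaton. It has at most (|Q| + 2) (|w| + 2)^|V| configurations,
    which is polynomial, and a halting deterministic run visits each at most once ([sim_runs]). So
    [in_P_frag] only asks for a program that always halts with the right answer; nothing is said
    about the running time of the programs themselves. *)

Definition cell (Sigma : finType) := option (Sigma + unit).

Definition lmark (Sigma : finType) : cell Sigma := Some (inr tt).

Definition padded (Sigma : finType) (w : seq Sigma) : seq (cell Sigma) :=
  lmark Sigma :: rcons [seq Some (inl a) | a <- w] None.

Definition rd (Sigma : finType) (w : seq Sigma) (p : nat) : cell Sigma :=
  nth None (padded w) p.

Definition mv (N p : nat) (m : move) : nat :=
  match m with MoveLeft => p.-1 | Stay => p | MoveRight => minn p.+1 N.+1 end.

(* A two-way automaton with heads V and exits R.  A head stands on a position *)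
(* in 0 .. size w + 1, where 0 holds the left marker and size w + 1 a blank.  *)
Record frag (Sigma V R : finType) := Frag {
  fstate : finType;
  fentry : fstate;
  fdelta : fstate -> (V -> cell Sigma) -> (fstate + R) * (V -> move)
}.

Section Fragments.
Context {Sigma V : finType}.
Implicit Types (R S : finType) (w : seq Sigma) (e : V -> nat).

Definition fstep R (F : frag Sigma V R) w (q : fstate F) e :
    (fstate F + R) * (V -> nat) :=
  let d := fdelta q (fun v => rd w (e v)) in
  (d.1, fun v => mv (size w) (e v) (d.2 v)).

(** A derivation is a finite run, so every specification below includes termination without carrying
    a step count. *)
Inductive reach R (F : frag Sigma V R) w :
    fstate F -> (V -> nat) -> R -> (V -> nat) -> Prop :=
| reach_exit q e r e' : fstep w q e = (inr r, e') -> reach w q e r e'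
| reach_next q e q' e1 r e' :
    fstep w q e = (inl q', e1) -> reach w q' e1 r e' -> reach w q e r e'.

Definition runs R (F : frag Sigma V R) w e r e' := reach w (fentry F) e r e'.

Definition act R (f : (V -> cell Sigma) -> R * (V -> move)) : frag Sigma V R :=
  @Frag Sigma V R unit tt (fun _ c => (inr (f c).1, (f c).2)).

Definition ret R (r : R) : frag Sigma V R := act (fun _ => (r, fun=> Stay)).

(** The continuation depends on the exit of [F], hence one copy of the states of [G r] per exit [r].
    The last transition of [F] leads straight to the entry of [G r]. *)
Definition bind R S (F : frag Sigma V R) (G : R -> frag Sigma V S) :
    frag Sigma V S :=
  @Frag Sigma V S (fstate F + {r : R & fstate (G r)})%type (inl (fentry F))
    (fun s c => match s with
     | inl q => let d := fdelta q c in
        (inl (match d.1 with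
              | inl q' => inl q'
              | inr r => inr (Tagged (fun r => fstate (G r)) (fentry (G r)))
              end), d.2)
     | inr rq => let d := fdelta (tagged rq) c in
        (match d.1 with
         | inl q' => inl (inr (Tagged (fun r => fstate (G r)) q'))
         | inr s => inr s
         end, d.2)
     end).

Definition loop R (F : frag Sigma V (option R)) : frag Sigma V R :=
  @Frag Sigma V R (fstate F) (fentry F)
    (fun q c => let d := fdelta q c in
      (match d.1 with
       | inl q' => inl q'
       | inr None => inl (fentry F)
       | inr (Some r) => inr r
       end, d.2)).

Lemma runs_act R (f : (V -> cell Sigma) -> R * (V -> move)) w e r e' :
  (f (fun v => rd w (e v))).1 = r ->
  (forall v, mv (size w) (e v) ((f (fun v => rd w (e v))).2 v) = e' v) ->
  runs (act f) w e r e'.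
Proof.
move=> <- He; apply: reach_exit; rewrite /fstep /=; congr pair.
by apply: funext.
Qed.

Lemma runs_ret R (r : R) w e : runs (ret r) w e r e.
Proof. exact: runs_act. Qed.

Lemma runs_bind R S (F : frag Sigma V R) (G : R -> frag Sigma V S)
    w e r e1 s e2 :
  runs F w e r e1 -> runs (G r) w e1 s e2 -> runs (bind F G) w e s e2.
Proof.
rewrite /runs /=; elim=> {}q {}e.
- move=> {}r {}e1 st1 st2.
  apply: (@reach_next _ (bind F G) w _ _
    (inr (Tagged (fun r => fstate (G r)) (fentry (G r)))) e1).
    by move: st1; rewrite /fstep /=; case: fdelta => d1 d2 /= [-> ->].
  elim: st2 {st1} => {}q1 {}e1.
  + move=> {}s {}e2 st; apply: (@reach_exit _ (bind F G)); move: st.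
    by rewrite /fstep /=; case: fdelta => d1' d2' /= [-> ->].
  + move=> q2 e2' {}s {}e2 st _ IH.
    apply: (@reach_next _ (bind F G)) IH; move: st.
    by rewrite /fstep /=; case: fdelta => d1' d2' /= [-> ->].
- move=> q1 e1' {}r {}e1 st _ IH st2.
  apply: (@reach_next _ (bind F G)) (IH st2); move: st.
  by rewrite /fstep /=; case: fdelta => d1' d2' /= [-> ->].
Qed.

Lemma reach_loop_exit R (F : frag Sigma V (option R)) w q e r e1 :
  reach (F := F) w q e (Some r) e1 -> reach (F := loop F) w q e r e1.
Proof.
move Er: (Some r) => o H; elim: H Er => {}q {}e.
- move=> {}o {}e1 st E; apply: (@reach_exit _ (loop F)); move: st; rewrite -E.
  by rewrite /fstep /=; case: fdelta => d1' d2' /= [-> ->].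
- move=> q2 e2' {}o {}e1 st _ IH E.
  apply: (@reach_next _ (loop F)) (IH E); move: st.
  by rewrite /fstep /=; case: fdelta => d1' d2' /= [-> ->].
Qed.

Lemma runs_loop_exit R (F : frag Sigma V (option R)) w e r e1 :
  runs F w e (Some r) e1 -> runs (loop F) w e r e1.
Proof. exact: reach_loop_exit. Qed.

Lemma reach_loop_next R (F : frag Sigma V (option R)) w q e e1 r e2 :
  reach (F := F) w q e None e1 -> runs (loop F) w e1 r e2 ->
  reach (F := loop F) w q e r e2.
Proof.
move Er: None => o H; elim: H Er => {}q {}e.
- move=> {}o {}e1 st E H2; apply: (@reach_next _ (loop F)) H2; move: st.
  by rewrite -E /fstep /=; case: fdelta => d1' d2' /= [-> ->].
- move=> q2 e2' {}o {}e1 st _ IH E H2.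
  apply: (@reach_next _ (loop F)) (IH E H2); move: st.
  by rewrite /fstep /=; case: fdelta => d1' d2' /= [-> ->].
Qed.

Lemma runs_loop_next R (F : frag Sigma V (option R)) w e e1 r e2 :
  runs F w e None e1 -> runs (loop F) w e1 r e2 -> runs (loop F) w e r e2.
Proof. exact: reach_loop_next. Qed.

End Fragments.

(** * A Turing machine with one copy of the input per head *)

Section Simulation.
Variables (Sigma V : finType) (F : frag Sigma V bool).

Let Q := fstate F.

(** Four phases, the outermost [None] first: write the left markers, copy the input to the tapes of
    the heads, rewind these tapes, run [F]. *)
Definition sim_state : finType := option (option (option (Q + bool))).

Definition head_tape (v : V) : 'I_#|V|.+1 := lift ord0 (enum_rank v).

Definition tape_head (i : 'I_#|V|.+1) : option V :=
  omap enum_val (unlift ord0 i).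

Lemma head_tapeK v : tape_head (head_tape v) = Some v.
Proof. by rewrite /tape_head /head_tape liftK /= enum_rankK. Qed.

(** Keeps a tape head on the padded word, as [mv] does for an abstract head: the two ends are
    recognised by the marker and the blank. *)
Definition clamp (c : cell Sigma) (m : move) : move :=
  match m, c with
  | MoveLeft, Some (inr _) => Stay
  | MoveRight, None => Stay
  | _, _ => m
  end.

Definition sim_delta (s : sim_state) (c : {ffun 'I_#|V|.+1 -> cell Sigma}) :
    sim_state * {ffun 'I_#|V|.+1 -> cell Sigma * move} :=
  match s with
  | None => (Some None, [ffun i => if i == ord0 then (c i, Stay)
                                   else (lmark Sigma, MoveRight)])
  | Some None =>
      if c ord0 is Some _ then (Some None, [ffun i => (c ord0, MoveRight)])
      else (Some (Some None), [ffun i => (None, MoveLeft)])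
  | Some (Some None) =>
      if [forall v, c (head_tape v) == lmark Sigma]
      then (Some (Some (Some (inl (fentry F)))), [ffun i => (c i, Stay)])
      else (Some (Some None), [ffun i => (c i, MoveLeft)])
  | Some (Some (Some (inl q))) =>
      let d := fdelta q (fun v => c (head_tape v)) in
      (Some (Some (Some d.1)),
       [ffun i => (c i, clamp (c i)
                    (if tape_head i is Some v then d.2 v else Stay))])
  | Some (Some (Some (inr b))) => (s, [ffun i => (c i, Stay)])
  end.

Definition sim_machine : turing_machine Sigma :=
  @TuringMachine Sigma #|V| sim_state unit None
    (fun s => if s is Some (Some (Some (inr b))) then Some b else None)
    sim_delta.

Variable w : seq Sigma.

Definition tape_at (p : nat) : tape (Sigma + unit) :=
  Tape (rev (take p (padded w))) (drop p (padded w)).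

Lemma size_padded : size (padded w) = (size w).+2.
Proof. by rewrite /padded /= size_rcons size_map. Qed.

Lemma tape_at_read p : tape_read (tape_at p) = rd w p.
Proof. by rewrite /tape_read /= -nth0 nth_drop addn0. Qed.

Lemma tape_at_stay p : p <= (size w).+1 ->
  tape_act (tape_at p) (rd w p, Stay) = tape_at p.
Proof.
move=> Hp; have := size_padded.
rewrite /tape_act /tape_at /rd; move: (padded w) => c Hs /=.
by rewrite (drop_nth None) ?Hs.
Qed.

Lemma tape_at_left p : p < (size w).+1 ->
  tape_act (tape_at p.+1) (rd w p.+1, MoveLeft) = tape_at p.
Proof.
move=> Hp; have := size_padded.
rewrite /tape_act /tape_at /rd; move: (padded w) => c Hs /=.
rewrite (take_nth None) ?Hs ?ltnS //; last by apply: ltnW.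
rewrite rev_rcons /=; congr Tape.
rewrite [RHS](drop_nth None) ?Hs; last by lia.
by rewrite [drop p.+1 _ in RHS](drop_nth None) ?Hs // -drop1 drop_drop add1n.
Qed.

Lemma tape_at_right p : p < (size w).+1 ->
  tape_act (tape_at p) (rd w p, MoveRight) = tape_at p.+1.
Proof.
move=> Hp; have := size_padded.
rewrite /tape_act /tape_at /rd; move: (padded w) => c Hs /=.
rewrite (take_nth None) ?Hs; last by lia.
rewrite rev_rcons; congr Tape.
by rewrite [drop p _](drop_nth None) ?Hs //; lia.
Qed.

Lemma rd_letter p : p < size w -> exists a, rd w p.+1 = Some (inl a).
Proof.
case: w => // a0 w' Hp; exists (nth a0 (a0 :: w') p).
by rewrite /rd /padded /= -rcons_cons -map_cons nth_rcons size_map Hp (nth_map a0).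
Qed.

Lemma rd_end : rd w (size w).+1 = None.
Proof. by rewrite /rd /padded /= nth_rcons size_map ltnn eqxx. Qed.

Lemma rd_lmark p : p <= (size w).+1 -> (rd w p == lmark Sigma) = (p == 0).
Proof.
case: p => // p; rewrite ltnS leq_eqVlt => /predU1P[->|/rd_letter[a ->] //].
by rewrite rd_end.
Qed.

Lemma tape_at_act p m : p <= (size w).+1 ->
  tape_act (tape_at p) (rd w p, clamp (rd w p) m) = tape_at (mv (size w) p m).
Proof.
move=> Hp; case: m; last 1 first.
- move: Hp; rewrite leq_eqVlt => /predU1P[->|Hp].
    rewrite {2}rd_end tape_at_stay // /mv; congr tape_at; lia.
  rewrite (_ : clamp _ _ = MoveRight).
    by rewrite tape_at_right // /mv (minn_idPl _).
  by case: p Hp => [|p Hp] //; have [a ->] := @rd_letter p Hp.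
- case: p Hp => [|p] Hp; first exact: tape_at_stay.
  rewrite (_ : clamp _ _ = MoveLeft) ?tape_at_left //.
  move: Hp; rewrite ltnS leq_eqVlt => /predU1P[->|Hp]; first by rewrite rd_end.
  by have [a ->] := @rd_letter p Hp.
- exact: tape_at_stay.
Qed.

Let M := sim_machine.
Let st := @step Sigma M.

Let at_run (c : config M) (s : Q + bool) (e : V -> nat) :=
  cstate c = Some (Some (Some s)) /\
  forall v, ctapes c (head_tape v) = tape_at (e v).

Lemma sim_run_step c q e : at_run c (inl q) e ->
  (forall v, e v <= (size w).+1) ->
  at_run (st c) (fstep w q e).1 (fstep w q e).2.
Proof.
case: c => s ts [/= -> Hts] He; rewrite /st /step /=; split=> [|v] /=.
  congr (Some (Some (Some (fdelta _ _).1))); apply: funext => v.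
  by rewrite ffunE Hts tape_at_read.
rewrite !ffunE head_tapeK Hts tape_at_read tape_at_act //.
congr (tape_at (mv _ _ ((fdelta _ _).2 _))); apply: funext => u.
by rewrite ffunE Hts tape_at_read.
Qed.

Let rewinding (c : config M) (p : nat) :=
  cstate c = Some (Some None) /\ forall v, ctapes c (head_tape v) = tape_at p.

Lemma sim_rewind p c : rewinding c p -> p <= (size w).+1 ->
  exists2 t, t <= p.+1 & at_run (iter t st c) (inl (fentry F)) (fun=> 0).
Proof.
elim: p c => [|p IH] [s ts] [/= Es Hts] Hp; subst s.
  exists 1 => //=; rewrite /st /step /=.
  have -> : [forall v, [ffun i => tape_read (ts i)] (head_tape v) == lmark Sigma].
    by apply/forallP=> v; rewrite ffunE Hts tape_at_read.
  split=> //= v.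
  by rewrite !ffunE Hts tape_at_read tape_at_stay.
case: (boolP [forall v, [ffun i => tape_read (ts i)] (head_tape v) == lmark Sigma]).
  (* Away from position 0 this happens only if there are no heads at all. *)
  move=> H; exists 1 => //=; rewrite /st /step /= H; split=> //= v.
  by have := forallP H v; rewrite ffunE Hts tape_at_read rd_lmark.
move=> H.
have [||t Ht Hr] := IH (st (@Config _ M (Some (Some None)) ts)).
- rewrite /st /step /= (negbTE H); split=> //= v; rewrite !ffunE Hts tape_at_read.
  exact: tape_at_left.
- exact: ltnW.
by exists t.+1 => //; rewrite iterSr.
Qed.

(** Tape 0 is compared through [nth] because it is known only up to trailing blanks: on the empty
    input the first step writes an explicit blank. *)
Let copying (c : config M) (k : nat) :=
  let W := [seq Some (inl a) | a <- w] in
  [/\ cstate c = Some None,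
      forall i, nth None (tape_right (ctapes c ord0)) i = nth None W (k + i)
    & forall v, ctapes c (head_tape v) =
        Tape (rcons (rev (take k W)) (lmark Sigma)) [::]].

Lemma sim_copy k c : copying c k -> k <= size w ->
  exists2 t, t <= (size w - k).+1 & rewinding (iter t st c) (size w).
Proof.
move Ed: (size w - k) => d.
elim: d k c Ed => [|d IH] k [s ts] Ed [/= Es H0 Hv] Hk; subst s.
  have Ek : k = size w by lia.
  exists 1 => //=; rewrite /st /step /= ffunE /tape_read -nth0 H0 Ek addn0.
  rewrite nth_default ?size_map //=; split=> //= v.
  rewrite !ffunE Hv Ek /tape_act /tape_at /padded /=.
  move: (size_map (fun a => Some (inl a) : cell Sigma) w) => <-.
  rewrite take_size; move: [seq _ | _ <- w]; elim/last_ind=> // W a _.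
  rewrite size_rcons rev_rcons /= -[rcons (rcons _ _) _]cats1 -!cats1 -!catA.
  by rewrite take_size_cat // drop_size_cat // rev_cons cats1.
have Hk' : k < size w by lia.
have Hs : k < size [seq Some (inl a) : cell Sigma | a <- w] by rewrite size_map.
have [a Ha] : exists a,
    nth None [seq Some (inl a) : cell Sigma | a <- w] k = Some (inl a).
  by have [a] := rd_letter Hk'; rewrite /rd /padded /= nth_rcons Hs; exists a.
have [|||t Ht Hr] := IH k.+1 (st (@Config _ M (Some None) ts)).
- lia.
- rewrite /st /step /= ffunE /tape_read -nth0 H0 addn0 Ha; split=> //= [i|v].
    by rewrite !ffunE /tape_act /= nth_behead H0 addSnnS.
  rewrite !ffunE Hv /tape_act /= (take_nth None) // rev_rcons Ha.
  by rewrite rcons_cons.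
- lia.
by exists t.+1; [lia | rewrite iterSr].
Qed.

Lemma sim_setup : exists2 t, t <= (size w).*2 + 3 &
  at_run (iter t st (init M w)) (inl (fentry F)) (fun=> 0).
Proof.
have Hc : copying (st (init M w)) 0.
  rewrite /st /step /=; split=> //= [i|v]; rewrite !ffunE /= ?take0.
    rewrite /tape_act /tape_read /=.
    by case: w i => [|? ?] [|[]].
  by rewrite /tape_act.
have [//|t1 Ht1 H1] := sim_copy Hc.
have [//|t2 Ht2 H2] := sim_rewind H1.
exists (t2 + (t1 + 1)); first by rewrite subn0 in Ht1; lia.
by rewrite !iterD.
Qed.

(** The finite set of configurations on [w]. Exits are fixpoints of [cfg_step], which makes it a
    total function. *)
Let C : finType := ((Q + bool) * {ffun V -> 'I_(size w).+2})%type.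

Let cfg_step (x : C) : C :=
  match x.1 with
  | inl q => let y := fstep w q (fun v => x.2 v) in
             (y.1, [ffun v => inord (y.2 v)])
  | inr b => x
  end.

Lemma cfg_stepE q (o : {ffun V -> 'I_(size w).+2}) v :
  (cfg_step (inl q, o)).2 v = (fstep w q (fun v => o v)).2 v :> nat.
Proof.
rewrite /cfg_step ffunE inordK //= ltnS.
by have := ltn_ord (o v); case: ((fdelta _ _).2 v) => /=; lia.
Qed.

Lemma sim_cfg_step c (x : C) : at_run c x.1 (fun v => x.2 v) ->
  at_run (st c) (cfg_step x).1 (fun v => (cfg_step x).2 v).
Proof.
case: x => [[q|b] o] H.
  have [|E1 E2] := sim_run_step H; first by move=> v; rewrite -ltnS ltn_ord.
  by split=> // v; rewrite cfg_stepE.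
by have -> : st c = c by rewrite /st /step; case: H => ->.
Qed.

Lemma reach_iter q e r e' : reach (F := F) w q e r e' ->
  forall o : {ffun V -> 'I_(size w).+2}, (forall v, o v = e v :> nat) ->
  exists t o', iter t cfg_step (inl q, o) = (inr r, o').
Proof.
elim=> {}q {}e.
  move=> {}r {}e' E o Ho; have Ee : e = (fun v => o v : nat) by apply: funext.
  subst e; exists 1, (cfg_step (inl q, o)).2.
  by rewrite /= [LHS]surjective_pairing; congr pair; exact: (congr1 fst E).
move=> q' e1 {}r {}e' E _ IH o Ho.
have Ee : e = (fun v => o v : nat) by apply: funext.
subst e; have [|t [o' Ht]] := IH (cfg_step (inl q, o)).2.
  by move=> v; rewrite cfg_stepE E.
exists t.+1, o'; rewrite iterSr -Ht; congr iter.
by rewrite [LHS]surjective_pairing; congr pair; exact: (congr1 fst E).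
Qed.

(** The first arrival at the halted configuration, given by [findex], comes before any repetition,
    so the number of configurations bounds the time. *)
Lemma sim_runs r e' : runs F w (fun=> 0) r e' ->
  exists2 t, t <= (size w).*2 + 3 + (#|Q| + 2) * (size w + 2) ^ #|V| &
  verdict (cstate (iter t st (init M w))) = Some r.
Proof.
move=> H; have [t0 Ht0 H0] := sim_setup.
pose x0 : C := (inl (fentry F), [ffun=> ord0]).
have [v|t [o' Ht]] := @reach_iter _ _ _ _ H x0.2; first by rewrite ffunE.
have Hx : fconnect cfg_step x0 (inr r, o') by rewrite -Ht fconnect_iter.
pose t1 := findex cfg_step x0 (inr r, o').
have Ht1 : iter t1 cfg_step x0 = (inr r, o') by apply: iter_findex.
have Hlt : t1 <= (#|Q| + 2) * (size w + 2) ^ #|V|.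
  rewrite ltnW // (leq_trans (findex_max Hx)) // (leq_trans (max_card _)) //.
  by rewrite card_prod card_sum card_bool card_ffun card_ord !addn2.
exists (t1 + t0); first lia.
rewrite iterD.
have : at_run (iter t0 st (init M w)) x0.1 (fun v => x0.2 v).
  by case: H0 => E1 E2; split=> // v; rewrite E2 ffunE.
have : (iter t1 cfg_step x0).1 = inr r by rewrite Ht1.
move: (t1) (x0) (iter t0 st _) => {Ht Hx Ht1 Hlt H0 t}. elim=> [|{}t1 IH] x c.
  by move=> /= -> [-> _].
by rewrite !iterSr => E /sim_cfg_step; apply: IH.
Qed.

End Simulation.

Lemma in_P_frag (Sigma V : finType) (F : frag Sigma V bool)
    (L : language Sigma) :
  (forall w, exists (b : bool) e', runs F w (fun=> 0) b e' /\ (b <-> L w)) ->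
  in_P L.
Proof.
move=> H; exists (sim_machine F).
exists ('X * 2%:P + 3%:P +
        (#|fstate F| + 2)%:P * ('X + 2%:P) ^+ #|V|)%R => w.
have [b [e' [/sim_runs[t Ht Hv] Hb]]] := H w.
exists t, b; split=> //; apply: leq_trans Ht _.
rewrite !(hornerD, hornerM, horner_exp, hornerC, hornerX).
by rewrite -muln2 -natrXE.
Qed.

(** * Heads and programs *)

Lemma rd_cat (Sigma : finType) (u v : seq Sigma) a :
  rd (u ++ a :: v) (size u).+1 = Some (inl a).
Proof.
rewrite /rd /padded /= map_cat /= rcons_cat /= nth_cat size_map ltnn subnn.
by [].
Qed.

Lemma mv_right N p : p <= N -> mv N p MoveRight = p.+1.
Proof. by move=> Hp; apply/minn_idPl. Qed.

Lemma split_row (v : seq symbol) :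
  exists b, (exists v', v = row b ++ v') \/ v = [seq Some d | d <- b].
Proof.
elim: v => [|[d|] v [b IH]]; first by exists [::]; right.
  by exists (d :: b); case: IH => [[v' ->]|->]; [left; exists v' | right].
by exists [::]; left; exists v.
Qed.

Lemma size_row b : size (row b) = (size b).+1.
Proof. by rewrite size_rcons size_map. Qed.

Definition kval (b : seq bool) : nat :=
  foldl (fun v d : nat => v.*2 + d) 0 [seq nat_of_bool d | d <- b].

Lemma kval_rcons b d : kval (rcons b d) = (kval b).*2 + d.
Proof. by rewrite /kval map_rcons -cats1 foldl_cat. Qed.

Definition canonical_digits (v : seq symbol) : bool :=
  match v with
  | Some true :: v' => all isSome v'
  | Some false :: v' => v' == [::]
  | _ => false
  end.

Section Program.
Variable n : nat.

(** The utilities of all agents for a good, with its initial owner; [good_move] adds the final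
    owner. *)
Definition good_class : finType := ({ffun 'I_n -> bool} * 'I_n)%type.
Definition good_move : finType := (good_class * 'I_n)%type.

(* In this order: one head per row of the input and one for the number k; the *)
(* guess x; the part of x used so far, from which x is restored; the values   *)
(* u_i(A_j); the number of moved goods, with a scratch head to halve it.      *)
Definition heads : finType :=
  ('I_(n + n).+1 + good_move + good_move + 'I_n * 'I_n + bool)%type.

Definition pack T (r : 'I_(n + n).+1 -> T) (x y : good_move -> T)
    (c : 'I_n * 'I_n -> T) (s t : T) : heads -> T := fun v =>
  match v with
  | inl (inl (inl (inl i))) => r i
  | inl (inl (inl (inr p))) => x p
  | inl (inl (inr p)) => y p
  | inl (inr a) => c a
  | inr false => s
  | inr true => t
  end.

Definition rh (j : nat) : heads := inl (inl (inl (inl (inord j)))).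
Definition kh : heads := rh (n + n).
Definition xh (p : good_move) : heads := inl (inl (inl (inr p))).
Definition yh (p : good_move) : heads := inl (inl (inr p)).
Definition ch (a : 'I_n * 'I_n) : heads := inl (inr a).
Definition sh : heads := inr false.
Definition th : heads := inr true.

Notation still := (fun=> Stay).
Notation prog R := (frag symbol heads R).

Lemma runs_pack (R : finType)
    (f : (heads -> cell symbol) -> R * (heads -> move)) w
    r x y c s t res r' x' y' c' s' t' mr mx my mc ms mt :
  f (fun v => rd w (pack r x y c s t v)) = (res, pack mr mx my mc ms mt) ->
  (forall i, mv (size w) (r i) (mr i) = r' i) ->
  (forall i, mv (size w) (x i) (mx i) = x' i) ->
  (forall i, mv (size w) (y i) (my i) = y' i) ->
  (forall i, mv (size w) (c i) (mc i) = c' i) ->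
  mv (size w) s ms = s' -> mv (size w) t mt = t' ->
  runs (act f) w (pack r x y c s t) res (pack r' x' y' c' s' t').
Proof.
move=> E Hr Hx Hy Hc Hs Ht; apply: runs_act; rewrite E //=.
by case=> [[[[i|i]|i]|i]|[]] /=.
Qed.

Lemma runs_pack_still (R : finType)
    (f : (heads -> cell symbol) -> R * (heads -> move)) w
    r x y c s t res :
  f (fun v => rd w (pack r x y c s t v)) =
    (res, pack still still still still Stay Stay) ->
  runs (act f) w (pack r x y c s t) res (pack r x y c s t).
Proof. by move=> E; apply: (runs_pack E). Qed.

Definition stand := pack still still still still Stay Stay.

(** All heads from [j] on pass the next separator together. Doing this for [j] = 1, 2, ... leaves
    head [i] at the start of row [i]. *)
Definition seek (j : nat) : prog bool := loop (act (fun g =>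
  let m := pack (fun i => if j <= i then MoveRight else Stay)
             still still still Stay Stay in
  match g (rh j) with
  | Some (inl None) => (Some true, m)
  | None => (Some false, stand)
  | _ => (None, m)
  end)).

Definition seeks (l : seq nat) : prog bool :=
  foldr (fun j F => bind (seek j) (fun b => if b then F else ret false))
        (ret true) l.

Implicit Types (r : 'I_(n + n).+1 -> nat) (x y : good_move -> nat)
  (c : 'I_n * 'I_n -> nat).

Lemma seek_true j w u b v r x y c s t : j <= n + n -> w = u ++ row b ++ v ->
  (forall i : 'I_(n + n).+1, j <= i -> r i = (size u).+1) ->
  runs (seek j) w (pack r x y c s t) true
    (pack (fun i => if j <= i then (size (u ++ row b)).+1 else r i) x y c s t).
Proof.
move=> Hj; elim: b u r => [|d b IH] u r Ew Hr; have Hrj := Hr (inord j).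
  apply: runs_loop_exit; apply: runs_pack; [by
    rewrite [pack _ _ _ _ _ _ _]Hrj ?inordK // Ew rd_cat; reflexivity
    | move=> i /= | by [] ..].
  case: ifP => // /Hr ->; rewrite /= Ew !size_cat /=; lia.
have E : row (d :: b) = [:: Some d] ++ row b by [].
have E1 : w = (u ++ [:: Some d]) ++ row b ++ v by rewrite Ew E -!catA.
have := IH _ (fun i => if j <= i then (size u).+2 else r i) E1.
have E2 (i : 'I_(n + n).+1) : j <= i ->
    (if j <= i then (size u).+2 else r i) = (size (u ++ [:: Some d])).+1.
  by move=> ->; rewrite size_cat addn1.
move/(_ E2); set e := pack _ _ _ _ _ _ => H.
apply: (@runs_loop_next _ _ _ _ _ _ e).
  apply: runs_pack; [by
    rewrite [pack _ _ _ _ _ _ _]Hrj ?inordK // Ew E -!catA rd_cat; reflexivity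
    | move=> i /= | by [] ..].
  case: ifP => // /Hr ->; rewrite /= Ew !size_cat /=; lia.
congr (runs _ _ _ _ (pack _ _ _ _ _ _)): H; apply: funext => i.
by rewrite -catA; case: (j <= i).
Qed.

Lemma seek_false j w u b r x y c s t :
  j <= n + n -> w = u ++ [seq Some d | d <- b] ->
  (forall i : 'I_(n + n).+1, j <= i -> r i = (size u).+1) ->
  exists r', runs (seek j) w (pack r x y c s t) false (pack r' x y c s t).
Proof.
move=> Hj; elim: b u r => [|d b IH] u r Ew Hr; have Hrj := Hr (inord j).
  exists r; apply: runs_loop_exit; apply: runs_pack_still => //.
  by rewrite [pack _ _ _ _ _ _ _]Hrj ?inordK // Ew cats0 rd_end.
have [||r' H] := IH (u ++ [:: Some d]) (fun i => if j <= i then (size u).+2 else r i).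
- by rewrite Ew -catA.
- by move=> i ->; rewrite size_cat addn1.
exists r'; apply: runs_loop_next H; apply: runs_pack; [by
  rewrite [pack _ _ _ _ _ _ _]Hrj ?inordK // Ew rd_cat; reflexivity
  | move=> i /= | by [] ..].
case: ifP => // /Hr ->; rewrite /= Ew !size_cat /=; lia.
Qed.

(** Each round strips one row from [v], and head [i] takes part in the rounds [j] to [i]. Failure
    means too few separators for an encoding. *)
Lemma seeks_spec k j w u v r x y c (s t : nat) :
  j + k = (n + n).+1 -> w = u ++ v ->
  (forall i : 'I_(n + n).+1, j <= i -> r i = (size u).+1) ->
  exists b r', runs (seeks (iota j k)) w (pack r x y c s t) b (pack r' x y c s t)
  /\ if b then exists rs rest,
       [/\ size rs = k, v = flatten [seq row l | l <- rs] ++ rest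
         & forall i : 'I_(n + n).+1, r' i =
            if j <= i then
              (size (u ++ flatten [seq row l | l <- take (i.+1 - j) rs])).+1
            else r i]
     else count_mem None v < k.
Proof.
elim: k j u v r => [|k IH] j u v r Hjk Ew Hr.
  exists true, r; split; first exact: runs_ret.
  by exists [::], v; split=> // i; case: ifP => // /Hr ->; rewrite cats0.
have Hj : j <= n + n by lia.
have [b [[v' Ev]|Ev]] := split_row v; last first.
  have E1 : w = u ++ [seq Some d | d <- b] by rewrite Ew Ev.
  have [r' H] := seek_false x y c s t Hj E1 Hr.
  exists false, r'; split; first by apply: runs_bind H _; exact: runs_ret.
  suff -> : count_mem None v = 0 by [].
  by rewrite Ev; elim: (b).
have E1 : w = u ++ row b ++ v' by rewrite Ew Ev.
have H1 := seek_true x y c s t Hj E1 Hr.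
have [||i Hi|b2 [r2 [H2 Hb2]]] := IH j.+1 (u ++ row b) v'
    (fun i => if j <= i then (size (u ++ row b)).+1 else r i).
- lia.
- by rewrite E1 catA.
- by rewrite ltnW.
exists b2, r2; split; first exact: runs_bind H1 H2.
case: b2 {H2} Hb2 => /= [[rs [rest [Hs Hv Hr2]]]|Hc].
  exists (b :: rs), rest; split=> [||i] /=; rewrite ?Hs //.
    by rewrite Ev Hv -catA.
  rewrite Hr2; case: (ltngtP j i) => Hi //; last by rewrite Hi subSnn /= take0 /= cats0.
  by rewrite subSS subSn ?(ltnW Hi) //= -catA.
rewrite Ev count_cat /row -cats1 count_cat /= addn0.
suff -> : count_mem None [seq Some d | d <- b] = 0 by rewrite add0n add1n ltnS.
by elim: (b).
Qed.

(** [Some None] is the end of the table, where all rows show a separator. [None] is a malformed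
    column: rows of unequal length, or a good without exactly one owner. *)
Definition classify (f g : 'I_n -> cell symbol) : option (option good_class) :=
  if [forall i, f i == Some (inl None)] && [forall i, g i == Some (inl None)]
  then Some None
  else omap Some [pick k : good_class |
    [forall i, f i == Some (inl (Some (k.1 i)))] &&
    [forall i, g i == Some (inl (Some (i == k.2)))]].

(** Any [j] with budget left would do, as only counts are tested. What is taken from x is recorded
    in y, so that x can be restored. *)
Definition assign_column : prog (option bool) := act (fun g =>
  match classify (fun i => g (rh i)) (fun i => g (rh (n + i))) with
  | None => (Some false, stand)
  | Some None => (Some true, stand)
  | Some (Some k) =>
      if [pick j | g (xh (k, j)) != lmark symbol] is Some j then
        (None, pack (fun i => if i < n + n then MoveRight else Stay)
                 (fun p => if p == (k, j) then MoveLeft else Stay)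
                 (fun p => if p == (k, j) then MoveRight else Stay)
                 (fun a => if k.1 a.1 && (a.2 == j) then MoveRight else Stay)
                 (if j != k.2 then MoveRight else Stay) Stay)
      else (Some false, stand)
  end).

Definition assign_columns : prog bool := loop assign_column.

Definition gain (z : seq good_move) (a : 'I_n * 'I_n) : nat :=
  count (fun p : good_move => p.1.1 a.1 && (a.2 == p.2)) z.

Definition cost (z : seq good_move) : nat :=
  count (fun p : good_move => p.2 != p.1.2) z.

(** * Scanning the table column by column *)

Section Columns.
Variables (rs : seq (seq bool)) (rest : seq symbol).
Hypotheses (n_gt0 : 0 < n) (size_rs : size rs = n + n).

Let w := flatten [seq row l | l <- rs] ++ rest.

Definition row_pos (i : nat) : nat :=
  (size (flatten [seq row l | l <- take i rs])).+1.

(** The default [None] is also the separator, so a row reads as ended from its length on. *)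
Definition entry (i g : nat) : symbol := nth None (row (nth [::] rs i)) g.

Definition column (g : nat) : option (option good_class) :=
  classify (fun i => Some (inl (entry i g)))
           (fun i => Some (inl (entry (n + i) g))).

Lemma columnP g k : column g = Some (Some k) <->
  (forall i : 'I_n, entry i g = Some (k.1 i)) /\
  (forall i : 'I_n, entry (n + i) g = Some (i == k.2)).
Proof.
rewrite /column /classify; case: ifP => [/andP[/forallP H1 _]|_].
  by split=> // [[/(_ (Ordinal n_gt0)) E _]]; have := H1 (Ordinal n_gt0); rewrite E.
case: pickP => [k' /andP[/forallP H1 /forallP H2]|H] /=.
  split=> [[<-]|[H3 H4]].
    by split=> i; [case/eqP: (H1 i) | case/eqP: (H2 i)].
  congr (Some (Some _)); case: k' k H1 H2 H3 H4 => [f i] [f' i'] /= H1 H2 H3 H4.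
  congr pair; first by apply/ffunP=> j; have := eqP (H1 j); rewrite H3; case.
  by have := eqP (H2 i); rewrite H4 eqxx; case=> /eqP.
split=> // [[H1 H2]]; have := H k; rewrite /= => /negP[].
by apply/andP; split; apply/forallP=> i; rewrite ?H1 ?H2.
Qed.

Lemma column_endP g : column g = Some None <->
  forall i, i < n + n -> entry i g = None.
Proof.
rewrite /column /classify; case: ifP => [/andP[/forallP H1 /forallP H2]|/negP H].
  split=> // _ i Hi; case: (ltnP i n) => Hin.
    by case/eqP: (H1 (Ordinal Hin)).
  have Hi' : i - n < n by lia.
  by case/eqP: (H2 (Ordinal Hi')); rewrite /= subnKC.
split; first by case: pickP.
move=> E; case: H; apply/andP; split; apply/forallP=> i; rewrite E //.
  by rewrite ltn_addr.
by rewrite ltn_add2l.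
Qed.

Lemma entry_lt i g d : entry i g = Some d -> g < size (nth [::] rs i).
Proof.
rewrite /entry /row; case: ltnP => // Hg.
by rewrite nth_rcons size_map ltnNge Hg /=; case: ifP.
Qed.

Lemma column_lt g k i : column g = Some (Some k) -> i < n + n ->
  g < size (nth [::] rs i).
Proof.
move=> /columnP[H1 H2] Hi; case: (ltnP i n) => Hin.
  exact: entry_lt (H1 (Ordinal Hin)).
have Hi' : i - n < n by lia.
by have := entry_lt (H2 (Ordinal Hi')); rewrite /= subnKC.
Qed.

Lemma rd_row i g : i < n + n -> g <= size (nth [::] rs i) ->
  rd w (row_pos i + g) = Some (inl (entry i g)).
Proof.
rewrite -size_rs => Hi Hg.
have Hg' : g < size (row (nth [::] rs i)) by rewrite size_row.
rewrite /w -{1}(cat_take_drop i rs) (drop_nth [::]) // map_cat flatten_cat /=.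
rewrite -{1}(cat_take_drop g (row _)) (drop_nth None) //.
set u := flatten _; set u1 := take g _.
have -> : row_pos i + g = (size (u ++ u1)).+1.
  by rewrite size_cat size_takel ?addSn // ltnW.
rewrite -!catA /= [u ++ _]catA; exact: rd_cat.
Qed.

Lemma row_pos_lt i g : i < n + n -> g <= size (nth [::] rs i) ->
  row_pos i + g <= size w.
Proof.
rewrite -size_rs => Hi Hg; rewrite /w -{1}(cat_take_drop i rs) (drop_nth [::]) //.
rewrite map_cat flatten_cat /= !size_cat size_row /row_pos.
rewrite addSnnS -!addnA leq_add2l; lia.
Qed.

(** The loop invariant: head positions once the first goods have been handed out as recorded in
    [z]. *)
Definition scan_heads (x0 : good_move -> nat) (z : seq good_move) :
    heads -> nat :=
  pack (fun i => if i < n + n then row_pos i + size z else row_pos i)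
    (fun p => x0 p - count_mem p z) (fun p => count_mem p z) (gain z) (cost z) 0.

Lemma column_read x0 z :
  (forall i, i < n + n -> size z <= size (nth [::] rs i)) ->
  classify (fun i => rd w (scan_heads x0 z (rh i)))
           (fun i => rd w (scan_heads x0 z (rh (n + i)))) = column (size z).
Proof.
move=> Hs; rewrite /column; congr classify; apply: funext => i.
  have Hi : i < n + n by rewrite ltn_addr.
  by rewrite /scan_heads /= inordK ?Hi ?rd_row ?Hs // ltnW.
have Hi : n + i < n + n by rewrite ltn_add2l.
by rewrite /scan_heads /= inordK ?Hi ?rd_row ?Hs // ltnW.
Qed.

(** Induction on the unread part of row 0. The scan stops at the end of the table, at a malformed
    column, or at a good whose class [k] has used up its budget for every [j]. *)
Lemma assign_columnsP x0 z :
  (forall p, x0 p <= (size w).+1) ->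
  [seq Some (Some p.1) | p <- z] = [seq column g | g <- iota 0 (size z)] ->
  (forall p, count_mem p z <= x0 p) ->
  (forall i, i < n + n -> size z <= size (nth [::] rs i)) ->
  exists b z',
  [/\ runs assign_columns w (scan_heads x0 z) b (scan_heads x0 z'),
      [seq Some (Some p.1) | p <- z'] = [seq column g | g <- iota 0 (size z')],
      forall p, count_mem p z' <= x0 p,
      forall i, i < n + n -> size z' <= size (nth [::] rs i)
    & if b then column (size z') = Some None
      else column (size z') = None \/ exists k, column (size z') = Some (Some k)
             /\ forall j, count_mem (k, j) z' = x0 (k, j)].
Proof.
move=> Hx0; have n2_gt0 : 0 < n + n by lia.
move Ed: (size (nth [::] rs 0) - size z) => d.
elim: d z Ed => [|d IH] z Ed Hz Hc Hs; have Er := column_read x0 Hs.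
(* The counters of [z] are at most [size z], so no right move saturates. *)
all: have Hzw : size z < size w by
  have := row_pos_lt n2_gt0 (Hs _ n2_gt0); rewrite /row_pos; lia.
all: case Ec: (column (size z)) => [[k|]|]; last first;
  first by (exists false, z; split=> //; [apply: runs_loop_exit;
    apply: runs_pack_still; rewrite Er Ec | left]).
all: try by (exists true, z; split=> //; apply: runs_loop_exit;
    apply: runs_pack_still; rewrite Er Ec).
  (* Row 0 is exhausted, so the column cannot show a class. *)
  by have := column_lt Ec n2_gt0; lia.
pose g v := rd w (scan_heads x0 z v).
case Ep: [pick j | g (xh (k, j)) != lmark symbol] => [j|]; last first.
  exists false, z; split=> //.
    by apply: runs_loop_exit; apply: runs_pack_still; rewrite Er Ec -/g Ep.
  right; exists k; split=> // j; move: Ep; case: pickP => // /(_ j) /negbFE.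
  have := Hc (k, j); have := Hx0 (k, j).
  rewrite /g /= => H1 H2; rewrite rd_lmark => [H3 _|].
    by apply/anti_leq; rewrite H2 -subn_eq0.

  exact: leq_trans (leq_subr _ _) H1.
have Hj : count_mem (k, j) z < x0 (k, j).
  move: Ep; case: pickP => // j' Hj' [?]; subst j'; move: Hj'.
  rewrite ltn_neqAle Hc andbT; apply: contra => /eqP E.
  by rewrite /g /= E subnn.
pose z1 := rcons z (k, j).
have Ecnt P : count P z1 = count P z + P (k, j).
  by rewrite /z1 -cats1 count_cat /= addn0.
have Hcz P : count P z < size w by apply: leq_ltn_trans (count_size _ _) Hzw.
have [||||b [z' [H1 H2 H3 H4 H5]]] := IH z1.
- by rewrite size_rcons subnS Ed.
- by rewrite size_rcons -addn1 iotaD !map_cat -Hz /= map_rcons cats1 Ec.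
- move=> p; rewrite Ecnt /= eq_sym; case: eqP => [->|_]; first by rewrite addn1.
  by rewrite addn0.
- by move=> i Hi; rewrite size_rcons; apply: column_lt Ec Hi.
exists b, z'; split=> //; apply: runs_loop_next H1.
apply: runs_pack; [by rewrite Er Ec -/g Ep; reflexivity | move=> i /=
  | move=> p /= | move=> p /= | move=> a /= | | by []].
- case Hi: (i < n + n) => //; rewrite mv_right; first by rewrite size_rcons addnS.
  by apply: row_pos_lt => //; apply: Hs.
- rewrite Ecnt /= [_ == p]eq_sym; case: eqP => _ /=; last by rewrite addn0.
  by rewrite addn1 subnS.
- rewrite Ecnt /= [_ == p]eq_sym; case: eqP => _; last by rewrite addn0.
  by rewrite mv_right ?addn1 // ltnW.
- rewrite /gain Ecnt /=; case: ifP => _; last by rewrite addn0.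
  by rewrite mv_right ?addn1 // ltnW.
- rewrite /cost Ecnt /=; case: ifP => _; last by rewrite addn0.
  by rewrite mv_right ?addn1 // ltnW.
Qed.

End Columns.

End Program.

(** * Testing fairness and cost on the counters, and resetting the heads *)

Section Checks.
Variable n : nat.
Implicit Types (r : 'I_(n + n).+1 -> nat) (x y : good_move n -> nat)
  (c : 'I_n * 'I_n -> nat) (s t : nat) (w : seq symbol).

Notation still := (fun=> Stay).
Notation prog R := (frag symbol (heads n) R).

(* Turns every u_i(A_j) into the truncated difference u_i(A_j) - u_i(A_i).    *)
Definition envy_margin : prog unit := loop (act (fun g =>
  if [exists a : 'I_n, g (ch (a, a)) != lmark symbol] then
    (None, pack still still still
       (fun a => if g (ch (a.1, a.1)) != lmark symbol then MoveLeft else Stay)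
       Stay Stay)
  else (Some tt, @stand n))).

(** After the truncated subtraction, one more left move brings a counter to 0 exactly when u_i(A_j)
    <= u_i(A_i) + 1. *)
Definition check_ef1 : prog bool :=
  bind envy_margin (fun _ =>
  bind (act (fun _ => (tt, pack still still still (fun=> MoveLeft) Stay Stay)))
  (fun _ => act (fun g =>
    ([forall a : 'I_n * 'I_n, g (ch a) == lmark symbol], @stand n)))).

(** The counter (i, i) paces all the (i, j) and is itself lowered, so each loses u_i(A_i) in total.
    The induction is on a bound for the diagonal counters. *)
Lemma runs_envy_margin w r x y c s t : (forall a, c a <= (size w).+1) ->
  runs envy_margin w (pack r x y c s t) tt
    (pack r x y (fun a => c a - c (a.1, a.1)) s t).
Proof.
have [m Hm] : exists m, forall a : 'I_n, c (a, a) <= m.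
  by exists (\max_a c (a, a)) => a; rewrite leq_bigmax.
elim: m c Hm => [|m IH] c Hm Hc.
  have H0 a : c (a, a) = 0 by apply/eqP; rewrite -leqn0.
  have -> : (fun a => c a - c (a.1, a.1)) = c.
    by apply: funext => a; rewrite H0 subn0.
  apply: runs_loop_exit; apply: runs_pack_still.
  by case: ifP => // /existsP[a] /=; rewrite H0.
pose c1 a := if c (a.1, a.1) is 0 then c a else (c a).-1.
case: (boolP [exists a : 'I_n, rd w (c (a, a)) != lmark symbol]) => E; last first.
  have H0 a : c (a, a) = 0.
    by move: E; rewrite negb_exists => /forallP/(_ a); rewrite negbK rd_lmark // => /eqP.
  have -> : (fun a => c a - c (a.1, a.1)) = c.
    by apply: funext => a; rewrite H0 subn0.
  apply: runs_loop_exit; apply: runs_pack_still.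
  by rewrite /= (negbTE E).
have -> : (fun a => c a - c (a.1, a.1)) = (fun a => c1 a - c1 (a.1, a.1)).
  apply: funext => a; rewrite /c1 /=; case Ea: (c (a.1, a.1)) => [|d] //=.
  by rewrite subnS; lia.
apply: (@runs_loop_next _ _ _ _ _ _ (pack r x y c1 s t)); last first.
  apply: IH => a; rewrite /c1 /=; first by have := Hm a; case: (c (a, a)).
  by case: (c (a.1, a.1)) => [|_]; [exact: Hc | exact: leq_trans (leq_pred _) (Hc a)].
apply: runs_pack; [by rewrite /= E; reflexivity | by [] | by [] | by []
  | move=> a /= | by [] | by []].
by rewrite /c1 rd_lmark //; case: (c (a.1, a.1)).
Qed.

Lemma runs_check_ef1 w r x y c s t : (forall a, c a <= (size w).+1) ->
  exists c', runs check_ef1 w (pack r x y c s t)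
    [forall a, c a <= (c (a.1, a.1)).+1] (pack r x y c' s t).
Proof.
move=> Hc; exists (fun a => (c a - c (a.1, a.1)).-1).
apply: runs_bind (runs_envy_margin _ _ _ _ _ Hc) _.
apply: (@runs_bind _ _ _ _ _ _ _ _ tt
  (pack r x y (fun a => (c a - c (a.1, a.1)).-1) s t)).
  by apply: runs_pack; [reflexivity | by [] ..].
apply: runs_pack_still; congr pair; apply: eq_forallb => a /=.
by rewrite rd_lmark; [lia | have := Hc a; lia].
Qed.

(** With [scan_right] and [at_end] this tests [canonical_digits]: anything may follow a leading 1,
    nothing a leading 0. On success the head of k is left on the last digit. *)
Definition read_first : prog (option bool) := act (fun g =>
  if g (kh n) is Some (inl (Some b))
  then (Some b, pack (fun i => if i == n + n :> nat then MoveRight else Stay)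
                  still still still Stay Stay)
  else (None, @stand n)).

Definition scan_right : prog bool := loop (act (fun g =>
  let m d := pack (fun i => if i == n + n :> nat then d else Stay)
               still still still Stay Stay in
  match g (kh n) with
  | Some (inl (Some _)) => (None, m MoveRight)
  | None => (Some true, m MoveLeft)
  | _ => (Some false, @stand n)
  end)).

Definition at_end : prog bool := act (fun g =>
  if g (kh n) is None
  then (true, pack (fun i => if i == n + n :> nat then MoveLeft else Stay)
                still still still Stay Stay)
  else (false, @stand n)).

(** Two left moves of [s] for one right move of [t]. A left move at 0 is void, so odd values are
    rounded up, which yields [uphalf]. *)
Definition halve_out : prog unit := loop (bind
  (act (fun g => if g (sh n) == lmark symbol then (false, @stand n)
                 else (true, pack still still still still MoveLeft MoveRight)))
  (fun b => if b then act (fun _ => (None, pack still still still still MoveLeft Stay))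
            else ret (Some tt))).

Definition halve_back : prog unit := loop (act (fun g =>
  if g (th n) == lmark symbol then (Some tt, @stand n)
  else (None, pack still still still still MoveRight MoveLeft))).

Definition halve : prog unit := bind halve_out (fun _ => halve_back).

(* The digits are read from the last one: s <= 2 k + b iff                    *)
(* uphalf (s - b) <= k, with truncated subtraction.                           *)
Definition read_bits : prog bool := loop (bind
  (act (fun g =>
    if g (kh n) is Some (inl (Some b)) then
      (None, pack (fun i => if i == n + n :> nat then MoveLeft else Stay)
               still still still (if b then MoveLeft else Stay) Stay)
    else (Some (g (sh n) == lmark symbol), @stand n)))
  (fun o => if o is Some b then ret (Some b) else bind halve (fun _ => ret None))).

Definition check_cost : prog bool := bind read_first (fun o =>
  if o is Some b then
    bind (if b then scan_right else at_end)
         (fun ok => if ok then read_bits else ret false)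
  else ret false).

Lemma runs_halve_out w r x y c s t : s <= (size w).+1 ->
  s + t <= (size w).+1 ->
  runs halve_out w (pack r x y c s t) tt (pack r x y c 0 (t + uphalf s)).
Proof.
elim/ltn_ind: s t => -[|s] IH t Hs Ht.
  rewrite addn0; apply: runs_loop_exit.
  apply: (@runs_bind _ _ _ _ _ _ _ _ false (pack r x y c 0 t)); last exact: runs_ret.
  exact: runs_pack_still.
apply: (@runs_loop_next _ _ _ _ _ _ (pack r x y c s.-1 t.+1)); last first.
  have -> : t + uphalf s.+1 = t.+1 + uphalf s.-1 by case: s {IH Hs Ht} => [|s] /=; lia.
  by apply: IH; lia.
apply: (@runs_bind _ _ _ _ _ _ _ _ true (pack r x y c s t.+1)).
  apply: runs_pack; [by rewrite /= rd_lmark; [reflexivity | lia] | by [] .. | ].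
  rewrite mv_right //; lia.
by apply: runs_pack; [reflexivity | by [] ..].
Qed.

Lemma runs_halve_back w r x y c s t : s + t <= (size w).+1 ->
  runs halve_back w (pack r x y c s t) tt (pack r x y c (s + t) 0).
Proof.
elim: t s => [|t IH] s Hs.
  by rewrite addn0; apply: runs_loop_exit; apply: runs_pack_still.
apply: (@runs_loop_next _ _ _ _ _ _ (pack r x y c s.+1 t)); last first.
  by rewrite -addSnnS; apply: IH; rewrite addSnnS.
apply: runs_pack; [by rewrite /= rd_lmark; [reflexivity | lia] | by [] .. | | by []].
rewrite mv_right //; lia.
Qed.

Lemma runs_halve w r x y c s : s <= (size w).+1 ->
  runs halve w (pack r x y c s 0) tt (pack r x y c (uphalf s) 0).
Proof.
move=> Hs; apply: runs_bind; first by apply: runs_halve_out; lia.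
rewrite -{2}[uphalf s]add0n; apply: runs_halve_back; lia.
Qed.

(** The tail [v] holds the digits already read. The separator in front of [b] ends the loop, where
    the test has become s <= 0. *)
Lemma runs_read_bits (u : seq symbol) (b : seq bool) (v : seq symbol) r x y c s :
  let w := u ++ None :: [seq Some d | d <- b] ++ v in
  s <= (size w).+1 -> r (inord (n + n)) = (size u).+1 + size b ->
  exists r' s', runs read_bits w (pack r x y c s 0) (s <= kval b)
                  (pack r' x y c s' 0).
Proof.
elim/last_ind: b v r s => [|b d IH] v r s w Hs Hr.
  exists r, s; apply: runs_loop_exit.
  apply: (@runs_bind _ _ _ _ _ _ _ _ (Some (s == 0)) (pack r x y c s 0)).
    by apply: runs_pack_still; rewrite /= Hr addn0 rd_cat rd_lmark.
  by rewrite leqn0; apply: runs_ret.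
have Ew : w = (u ++ None :: [seq Some d | d <- b]) ++ Some d :: v.
  by rewrite /w map_rcons cat_rcons -!catA.
pose r1 (i : 'I_(n + n).+1) := if i == n + n :> nat then (size u).+1 + size b else r i.
pose s1 := s - d.
have [||r' [s' H]] := IH (Some d :: v) r1 (uphalf s1).
- have -> : u ++ None :: [seq Some d | d <- b] ++ Some d :: v = w.
    by rewrite Ew -!catA.
  rewrite /s1; lia.
- by rewrite /r1 inordK ?eqxx.
exists r', s'; have -> : (s <= kval (rcons b d)) = (uphalf s1 <= kval b).
  rewrite kval_rcons /s1; case: d {Ew Hs s1 H w Hr} => /=; lia.
apply: runs_loop_next; last first.
  have <- : u ++ None :: [seq Some d | d <- b] ++ Some d :: v = w.
    by rewrite Ew -!catA.
  exact: H.
apply: (@runs_bind _ _ _ _ _ _ _ _ None (pack r1 x y c s1 0)); last first.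
  apply: runs_bind; first by apply: runs_halve; rewrite /s1; lia.
  exact: runs_ret.
have Erd : rd w (r (inord (n + n))) = Some (inl (Some d)).
  rewrite Hr Ew (_ : _ + _ = (size (u ++ None :: [seq Some d | d <- b])).+1) ?rd_cat //.
  by rewrite size_cat /= size_map size_rcons; lia.
apply: runs_pack; [by rewrite /= Erd; reflexivity | move=> i /= | by [] | by []
  | by [] | | by []].
- rewrite /r1; case: eqP => // Hi.
  have -> : i = inord (n + n) by apply: val_inj; rewrite /= inordK.
  by rewrite Hr size_rcons addnS.
- by rewrite /s1; case: (d) => /=; lia.
Qed.

Lemma runs_scan_right w u v r x y c s t : w = u ++ v ->
  r (inord (n + n)) = (size u).+1 ->
  exists r', runs scan_right w (pack r x y c s t) (all isSome v) (pack r' x y c s t)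
    /\ (all isSome v -> r' (inord (n + n)) = size w).
Proof.
elim: v u r => [|[b|] v IH] u r Ew Hr /=.
- exists (fun i : 'I_(n + n).+1 => if i == n + n :> nat then size w else r i).
  split; last by rewrite inordK ?eqxx.
  have Erd : rd w (r (inord (n + n))) = None by rewrite Hr Ew cats0 rd_end.
  apply: runs_loop_exit.
  apply: runs_pack; [by rewrite /= Erd; reflexivity | move=> i /= | by [] ..].
  case: eqP => // Hi; have -> : i = inord (n + n) by apply: val_inj; rewrite /= inordK.
  by rewrite Hr Ew cats0.
- have Erd : rd w (r (inord (n + n))) = Some (inl (Some b)) by rewrite Hr Ew rd_cat.
  pose r1 (i : 'I_(n + n).+1) := if i == n + n :> nat then (size u).+2 else r i.
  have [||r' [H1 H2]] := IH (rcons u (Some b)) r1.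
  + by rewrite cat_rcons.
  + by rewrite /r1 inordK ?eqxx // size_rcons.
  exists r'; split=> //; apply: runs_loop_next H1.
  apply: runs_pack; [by rewrite /= Erd; reflexivity | move=> i /= | by [] ..].
  rewrite /r1; case: eqP => // Hi.
  have -> : i = inord (n + n) by apply: val_inj; rewrite /= inordK.
  by rewrite Hr mv_right // Ew size_cat /= addnS ltnS leq_addr.
- exists r; split=> //; apply: runs_loop_exit; apply: runs_pack_still.
  by rewrite /= Hr Ew rd_cat.
Qed.

Lemma runs_at_end w u v r x y c s t : w = u ++ v ->
  r (inord (n + n)) = (size u).+1 ->
  exists r', runs at_end w (pack r x y c s t) (v == [::]) (pack r' x y c s t)
    /\ (v == [::] -> r' (inord (n + n)) = size w).
Proof.
case: v => [|b v] Ew Hr.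
- exists (fun i : 'I_(n + n).+1 => if i == n + n :> nat then size w else r i).
  split; last by rewrite inordK ?eqxx.
  have Erd : rd w (r (inord (n + n))) = None by rewrite Hr Ew cats0 rd_end.
  apply: runs_pack; [by rewrite /= Erd; reflexivity | move=> i /= | by [] ..].
  case: eqP => // Hi; have -> : i = inord (n + n) by apply: val_inj; rewrite /= inordK.
  by rewrite Hr Ew cats0.
- exists r; split=> //; apply: runs_pack_still.
  by rewrite /= Hr Ew rd_cat.
Qed.

Lemma all_isSomeP (v : seq symbol) : all isSome v ->
  exists b, v = [seq Some d | d <- b].
Proof.
elim: v => [_|[d|] v IH //= /IH[b ->]]; first by exists [::].
by exists (d :: b).
Qed.

Lemma runs_check_cost w u v r x y c s : w = u ++ None :: v -> s <= (size w).+1 ->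
  r (inord (n + n)) = (size u).+2 ->
  exists b r' s', runs check_cost w (pack r x y c s 0) b (pack r' x y c s' 0)
   /\ (b <-> exists k,
         [/\ v = [seq Some d | d <- k], canonical_digits v & s <= kval k]).
Proof.
move=> Ew Hs Hr; have Ew' : w = rcons u None ++ v by rewrite cat_rcons.
have Hr' : r (inord (n + n)) = (size (rcons u None)).+1 by rewrite size_rcons.
case Ev: v Ew Ew' => [|[b|] v1] Ew Ew'.
- exists false, r, s; split; last by split=> // -[k []].
  apply: (@runs_bind _ _ _ _ _ _ _ _ None (pack r x y c s 0)); last exact: runs_ret.
  by apply: runs_pack_still; rewrite /= Hr' Ew' cats0 rd_end.
- pose r1 (i : 'I_(n + n).+1) := if i == n + n :> nat then (size u).+3 else r i.
  have H1 : runs read_first w (pack r x y c s 0) (Some b) (pack r1 x y c s 0).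
    have Erd : rd w (r (inord (n + n))) = Some (inl (Some b)).
      by rewrite Hr' Ew' rd_cat.
    apply: runs_pack; [by rewrite /= Erd; reflexivity | move=> i /= | by [] ..].
    rewrite /r1; case: eqP => // Hi.
    have -> : i = inord (n + n) by apply: val_inj; rewrite /= inordK.
    by rewrite Hr mv_right // Ew size_cat /= !addnS !ltnS leq_addr.
  have E2 : w = rcons (rcons u None) (Some b) ++ v1 by rewrite cat_rcons.
  have Hr1 : r1 (inord (n + n)) = (size (rcons (rcons u None) (Some b))).+1.
    by rewrite /r1 inordK ?eqxx // !size_rcons.
  have [r2 [H2 H3]] : exists r2,
      runs (if b then scan_right else at_end) w (pack r1 x y c s 0)
        (canonical_digits (Some b :: v1)) (pack r2 x y c s 0) /\
      (canonical_digits (Some b :: v1) -> r2 (inord (n + n)) = size w).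
    by case: (b) => /=; [apply: runs_scan_right E2 Hr1 | apply: runs_at_end E2 Hr1].
  case Hc: (canonical_digits _) H2 H3 => H2 H3; last first.
    exists false, r2, s; split; last by split=> // -[k []].
    by apply: runs_bind H1 _; apply: runs_bind H2 _; apply: runs_ret.
  have [k Ek] : exists k, Some b :: v1 = [seq Some d | d <- k].
    apply: all_isSomeP; move: Hc => /=; case: (b) => // /eqP -> //.
  have Ew3 : w = u ++ None :: [seq Some d | d <- k] ++ [::] by rewrite cats0 -Ek.
  have [||r' [s' H4]] := @runs_read_bits u k [::] r2 x y c s.
  + by rewrite -Ew3.
  + by rewrite H3 // Ew3 size_cat /= cats0 size_map addnS.
  rewrite -Ew3 in H4; exists (s <= kval k), r', s'; split.
    by apply: runs_bind H1 _; apply: runs_bind H2 _.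
  split=> [Hk|[k' [Ek' _]]]; first by exists k.
  suff -> : k' = k by [].
  by apply: (@inj_map _ _ Some) => [? ? []|]; rewrite -?Ek' // -Ek.
- exists false, r, s; split; last by split=> // -[k []].
  apply: (@runs_bind _ _ _ _ _ _ _ _ None (pack r x y c s 0)); last exact: runs_ret.
  by apply: runs_pack_still; rewrite /= Hr' Ew' rd_cat.
Qed.

(** Undoes a failed attempt: each left step of y returns a unit to x, while the other heads go back
    to 0. *)
Definition clean : prog bool := loop (act (fun g =>
  if [forall v : heads n, (if v is inl (inl (inl (inr _))) then true
                           else g v == lmark symbol)]
  then (Some false, @stand n)
  else (None, pack (fun=> MoveLeft)
                (fun p => if g (yh p) == lmark symbol then Stay else MoveRight)
                (fun=> MoveLeft) (fun=> MoveLeft) MoveLeft MoveLeft))).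

Definition blank_heads x : heads n -> nat :=
  pack (fun=> 0) x (fun=> 0) (fun=> 0) 0 0.

Lemma runs_clean w r x y c s t :
  (forall i, r i <= (size w).+1) -> (forall p, x p + y p <= (size w).+1) ->
  (forall a, c a <= (size w).+1) -> s <= (size w).+1 -> t <= (size w).+1 ->
  runs clean w (pack r x y c s t) false (blank_heads (fun p => x p + y p)).
Proof.
move=> Hr Hxy Hc Hs Ht.
have [m Hm] : exists m, [/\ forall i, r i <= m, forall p, y p <= m,
    forall a, c a <= m, s <= m & t <= m].
  exists (size w).+1; split=> // p; exact: leq_trans (leq_addl _ _) (Hxy p).
elim: m r x y c s t Hm Hr Hxy Hc Hs Ht => [|m IH] r x y c s t
  [Mr My Mc Ms Mt] Hr Hxy Hc Hs Ht.
  have -> : r = (fun=> 0) by apply: funext => i; apply/eqP; rewrite -leqn0.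
  have Ey : y = (fun=> 0) by apply: funext => i; apply/eqP; rewrite -leqn0.
  have -> : c = (fun=> 0) by apply: funext => i; apply/eqP; rewrite -leqn0.
  have -> : s = 0 by apply/eqP; rewrite -leqn0.
  have -> : t = 0 by apply/eqP; rewrite -leqn0.
  have -> : (fun p => x p + y p) = x by apply: funext => p; rewrite Ey addn0.
  rewrite Ey; apply: runs_loop_exit; apply: runs_pack_still.
  by case: ifP => // /forallP[]; case=> [[[[i|i]|i]|i]|[]].
have Hy p : y p <= (size w).+1 := leq_trans (leq_addl _ _) (Hxy p).
case: (boolP [forall v : heads n, (if v is inl (inl (inl (inr _))) then true
                           else rd w (pack r x y c s t v) == lmark symbol)]) => E.
  have {}E := forallP E.
  have -> : (fun p => x p + y p) = x.
    by apply: funext => p; have := E (yh p); rewrite /= rd_lmark // => /eqP ->;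
      rewrite addn0.
  rewrite (_ : pack r x y c s t = blank_heads x); last first.
    apply: funext => v; have := E v.
    by case: v => [[[[i|i]|i]|i]|[]] //=; rewrite rd_lmark // => /eqP.
  apply: runs_loop_exit; apply: runs_pack_still.
  by case: ifP => // /forallP[]; case=> [[[[i|i]|i]|i]|[]].
pose x1 p := if y p is 0 then x p else (x p).+1.
have -> : (fun p => x p + y p) = (fun p => x1 p + (y p).-1).
  by apply: funext => p; rewrite /x1; case: (y p) => // d; rewrite addSnnS.
apply: (@runs_loop_next _ _ _ _ _ _ (pack (fun i => (r i).-1) x1
  (fun p => (y p).-1) (fun a => (c a).-1) s.-1 t.-1)); last first.
  apply: IH; try split; rewrite ?leq_pred_trans //.
  all: try by move=> i; rewrite -subn1 leq_subLR add1n.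
  all: try by move=> i; apply: leq_trans (leq_pred _) _.
  all: try by rewrite -subn1 leq_subLR add1n.
  all: try by apply: leq_trans (leq_pred _) _.
  move=> p; apply: leq_trans (Hxy p); rewrite /x1.
  by case: (y p) => // d; rewrite addSnnS.
apply: runs_pack; [by rewrite /= (negbTE E); reflexivity | by []
  | move=> p /= | by [] ..].
rewrite /x1 rd_lmark //; case Ey: (y p) => [|d] //=.
rewrite (minn_idPl _) //; apply: leq_trans (Hxy p).
by rewrite Ey addnS ltnS leq_addr.
Qed.

End Checks.

(** Yields the bounds on counters from the mere existence of a run. *)
Lemma reach_bounded (Sigma V R : finType) (F : frag Sigma V R) w q e r e' :
  reach (F := F) w q e r e' -> (forall v, e v <= (size w).+1) ->
  forall v, e' v <= (size w).+1.
Proof.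
have Hstep q0 e0 : (forall v, e0 v <= (size w).+1) ->
    forall v, (fstep (F := F) w q0 e0).2 v <= (size w).+1.
  move=> He v /=; have := He v.
  by case: ((fdelta _ _).2 v) => //=;
    [apply: leq_trans; apply: leq_pred | rewrite geq_minr].
elim=> {}q {}e.
  by move=> {}r {}e' E /(Hstep q); rewrite E.
by move=> q' e1 {}r {}e' E _ IH /(Hstep q); rewrite E.
Qed.

Lemma rd_endE (Sigma : finType) (w : seq Sigma) p : p <= (size w).+1 ->
  (rd w p == None) = (p == (size w).+1).
Proof.
rewrite leq_eqVlt => /predU1P[->|]; first by rewrite rd_end !eqxx.
case: p => [//|p]; rewrite ltnS => Hp.
by have [a ->] := rd_letter Hp; rewrite eqSS ltn_eqF.
Qed.

Lemma count_rows rs : count_mem None (flatten [seq row l | l <- rs]) = size rs.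
Proof.
elim: rs => //= b rs IH; rewrite count_cat IH /row -cats1 count_cat /= addn0.
by rewrite (_ : count_mem None [seq Some d | d <- b] = 0) //; elim: (b).
Qed.

Lemma row_inj b b' v v' : row b ++ v = row b' ++ v' -> b = b' /\ v = v'.
Proof.
elim: b b' => [|d b IH] [|d' b'] //=; first by case.
by case=> -> /IH[-> ->].
Qed.

Lemma rows_inj rs rs' v v' : size rs = size rs' ->
  flatten [seq row l | l <- rs] ++ v = flatten [seq row l | l <- rs'] ++ v' ->
  rs = rs' /\ v = v'.
Proof.
elim: rs rs' => [|b rs IH] [|b' rs'] //= [Hs].
by rewrite -!catA => /row_inj[-> /(IH _ Hs)[-> ->]].
Qed.

(** * The decision procedure: certificates, one attempt, enumeration of the guesses *)

Section Decider.
Variable n : nat.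
Hypothesis n_gt0 : 0 < n.

Notation still := (fun=> Stay).
Notation prog R := (frag symbol (heads n) R).

(** The utility rows, then the ownership rows, of the input. The final owners leave no trace in
    it. *)
Definition table (z : seq (good_move n)) : seq (seq bool) :=
  [seq [seq p.1.1 i | p : good_move n <- z] | i <- enum 'I_n] ++
  [seq [seq i == p.1.2 | p : good_move n <- z] | i <- enum 'I_n].

Definition fair (z : seq (good_move n)) : bool :=
  [forall a, gain z a <= (gain z (a.1, a.1)).+1].

(** [z] lists the goods in input order with their final owners; [0 < size z] mirrors [goods_ge1]. *)
Definition solution (w : seq symbol) (z : seq (good_move n)) : Prop :=
  exists k, [/\ w = flatten [seq row l | l <- table z] ++ [seq Some d | d <- k],
    0 < size z, canonical_digits [seq Some d | d <- k], fair z & cost z <= kval k].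

Lemma size_table z : size (table z) = n + n.
Proof. by rewrite size_cat 2!size_map size_enum_ord. Qed.

Lemma nth_table_util z (i : 'I_n) :
  nth [::] (table z) i = [seq p.1.1 i | p : good_move n <- z].
Proof.
rewrite nth_cat size_map size_enum_ord ltn_ord (nth_map i) ?size_enum_ord //.
by rewrite nth_ord_enum.
Qed.

Lemma nth_table_owner z (i : 'I_n) :
  nth [::] (table z) (n + i) = [seq i == p.1.2 | p : good_move n <- z].
Proof.
rewrite nth_cat size_map size_enum_ord ltnNge leq_addr /= addKn.
by rewrite (nth_map i) ?size_enum_ord // nth_ord_enum.
Qed.

Lemma size_nth_table z i : i < n + n -> size (nth [::] (table z) i) = size z.
Proof.
move=> Hi; case: (ltnP i n) => Hin.
  by rewrite (nth_table_util z (Ordinal Hin)) size_map.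
have Hi' : i - n < n by lia.
have := nth_table_owner z (Ordinal Hi'); rewrite /= subnKC // => ->.
by rewrite size_map.
Qed.

Lemma nth_row (f : good_move n -> bool) z d g : g < size z ->
  nth None (row [seq f p | p <- z]) g = Some (f (nth d z g)).
Proof.
by move=> Hg; rewrite nth_rcons !size_map Hg -map_comp (nth_map d).
Qed.

Lemma column_table z d g : g < size z ->
  column n (table z) g = Some (Some (nth d z g).1).
Proof.
move=> Hg; apply/columnP => //; split=> i; rewrite /entry.
  by rewrite nth_table_util (nth_row _ d).
by rewrite nth_table_owner (nth_row _ d).
Qed.

Lemma column_table_end z : column n (table z) (size z) = Some None.
Proof.
apply/column_endP; rewrite ?size_table // => i Hi; rewrite /entry -(size_nth_table z Hi).
by rewrite nth_rcons size_map ltnn eqxx.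
Qed.

(** Reading one class per column until all rows end together forces equal row lengths and determines
    every entry. *)
Lemma tableP rs z : size rs = n + n ->
  [seq Some (Some p.1) | p : good_move n <- z] =
    [seq column n rs g | g <- iota 0 (size z)] ->
  (forall i, i < n + n -> size z <= size (nth [::] rs i)) ->
  column n rs (size z) = Some None -> rs = table z.
Proof.
move=> Hrs Hz Hs /(column_endP n_gt0 Hrs) He.
have Hsz i : i < n + n -> size (nth [::] rs i) = size z.
  move=> Hi; apply/eqP; rewrite eqn_leq Hs // andbT leqNgt; apply/negP => Hlt.
  by have := He i Hi; rewrite /entry nth_rcons size_map Hlt (nth_map false).
have Hcol d g : g < size z -> column n rs g = Some (Some (nth d z g).1).
  move=> Hg; have := congr1 (fun s => nth None s g) Hz.
  by rewrite (nth_map d) // (nth_map 0) ?size_iota // nth_iota.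
have Hnth i g d : i < n + n -> g < size z ->
    nth d (nth [::] rs i) g = nth d (nth [::] (table z) i) g.
  move=> Hi Hg; have d0 : good_move n by case: (z) Hg.
  have Hg1 : g < size (nth [::] rs i) by rewrite Hsz.
  have Hg2 : g < size (nth [::] (table z) i) by rewrite size_nth_table.
  have : entry rs i g = entry (table z) i g.
    have /(columnP _ n_gt0)[H1 H2] := Hcol d0 g Hg.
    have /(columnP _ n_gt0)[H3 H4] := column_table d0 Hg.
    case: (ltnP i n) => Hin; first by rewrite (H1 (Ordinal Hin)) (H3 (Ordinal Hin)).
    have Hi' : i - n < n by lia.
    by have := H2 (Ordinal Hi'); have := H4 (Ordinal Hi'); rewrite /= subnKC // => -> ->.
  rewrite /entry !nth_rcons !size_map Hg1 Hg2 !(nth_map d) //.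
  by case.
apply: (@eq_from_nth _ [::]) => [|i]; rewrite Hrs ?size_table // => Hi.
apply: (@eq_from_nth _ false) => [|g]; rewrite Hsz ?size_nth_table // => Hg.
exact: Hnth.
Qed.

Definition andthen (F G : prog bool) : prog bool :=
  bind F (fun ok => if ok then G else ret false).

Lemma runs_andthen_false F G w e e1 :
  runs F w e false e1 -> runs (andthen F G) w e false e1.
Proof. by move=> H; apply: runs_bind H _; apply: runs_ret. Qed.

Lemma runs_andthen_true F G w e e1 b e2 :
  runs F w e true e1 -> runs G w e1 b e2 -> runs (andthen F G) w e b e2.
Proof. by move=> H1 H2; apply: runs_bind H1 _. Qed.

Definition enter_rows : prog unit :=
  act (fun _ => (tt, pack (fun=> MoveRight) still still still Stay Stay)).

Definition has_column : prog bool := act (fun g =>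
  (if g (rh n 0) is Some (inl (Some _)) then true else false, @stand n)).

Definition attempt : prog bool :=
  bind enter_rows (fun _ => andthen (seeks n (iota 1 (n + n)))
  (andthen has_column
  (andthen (assign_columns n) (andthen (check_ef1 n) (check_cost n))))).

Lemma count_class k (z : seq (good_move n)) :
  count (fun p : good_move n => p.1 == k) z = \sum_j count_mem (k, j) z.
Proof.
elim: z => [|p z IH] /=; first by rewrite big1.
rewrite big_split /= -IH; congr (_ + _).
case: eqP => [E|NE]; last first.
  by rewrite big1 // => j _; case: eqP => // E; case: NE; rewrite E.
rewrite (bigD1 p.2) //= big1 ?addn0; last first.
  by move=> j Hj; case: eqP => // Ep; move: Hj; rewrite Ep eqxx.
by rewrite -E -surjective_pairing eqxx.
Qed.

(** Acceptance is sound for every guess, and complete for the guess made of the letter counts of a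
    solution. On rejection x + y is still the guess, as [clean] needs. *)
Lemma runs_attempt w x0 : (forall p, x0 p <= (size w).+1) ->
  exists b e', [/\ runs attempt w (blank_heads x0) b e',
    b = false -> exists r x y c s t,
      e' = pack r x y c s t /\ forall p, x p + y p = x0 p,
    b -> exists z, solution w z
    & forall z, solution w z -> (forall p, x0 p = count_mem p z) -> b].
Proof.
move=> Hx0; have n2_gt0 : 0 < n + n by lia.
have H0 : runs enter_rows w (blank_heads x0) tt
    (pack (fun=> 1) x0 (fun=> 0) (fun=> 0) 0 0).
  by apply: runs_pack; [reflexivity | by move=> i; rewrite mv_right | by [] ..].
have Hr0 (i : 'I_(n + n).+1) : 1 <= i -> 1 = (size ([::] : seq symbol)).+1 by [].
have [b1 [r1 [H1 Hb1]]] := @seeks_spec n (n + n) 1 w [::] w (fun=> 1) x0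
  (fun=> 0) (fun=> 0) 0 0 erefl erefl Hr0.
have fin0 (r : 'I_(n + n).+1 -> nat) : exists r' x y c s t,
    pack r x0 (fun=> 0) (fun=> 0) 0 0 = pack r' x y c s t
    /\ forall p : good_move n, x p + y p = x0 p.
  by exists r, x0, (fun=> 0), (fun=> 0), 0, 0; split=> // p; rewrite addn0.
have H0' F b e' : runs F w (pack (fun=> 1) x0 (fun=> 0) (fun=> 0) 0 0) b e' ->
    runs (bind enter_rows (fun _ => F)) w (blank_heads x0) b e'.
  by move=> H; apply: runs_bind H0 H.
case: b1 H1 Hb1 => H1 /=; last first.
  move=> Hc; exists false, (pack r1 x0 (fun=> 0) (fun=> 0) 0 0); split=> //.
  - by apply: H0'; apply: runs_andthen_false H1.
  - move=> z [k [Ew _ _ _ _]] _; move: Hc; rewrite Ew count_cat count_rows size_table.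
    by rewrite ltnNge leq_addr.
case=> rs [rest [Hrs Ew Hr1]].
have uniq z : solution w z -> rs = table z /\ exists k,
   [/\ rest = [seq Some d | d <- k], 0 < size z, canonical_digits rest, fair z
     & cost z <= kval k].
  move=> [k [Ew' Hz Hk Hf Hc]].
  have Hst : size rs = size (table z) by rewrite Hrs size_table.
  have [|Ers Erest] := @rows_inj rs (table z) rest [seq Some d | d <- k] Hst.
    by rewrite -Ew -Ew'.
  by split=> //; exists k; rewrite Erest.
have Er1 : pack r1 x0 (fun=> 0) (fun=> 0) 0 0 = scan_heads rs x0 [::].
  rewrite /scan_heads; congr pack; apply: funext => i.
  - rewrite Hr1 addn0 if_same subn1 /row_pos /=.
    by case: (i : nat) => [|j] //=; rewrite take0.
  - by rewrite subn0.
have Erd : rd w (row_pos rs 0) = Some (inl (entry rs 0 0)).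
  by rewrite -[row_pos _ _]addn0 Ew; apply: (rd_row _ Hrs).
have Hne b : b = (0 < size (nth [::] rs 0)) ->
    runs has_column w (scan_heads rs x0 [::]) b (scan_heads rs x0 [::]).
  move=> ->; apply: runs_pack_still; rewrite /= inordK // n2_gt0 addn0 Erd.
  by rewrite /entry; case: (nth [::] rs 0).
rewrite Er1 in H1 fin0.
case Hs0 : (0 < size (nth [::] rs 0)); last first.
  exists false, (scan_heads rs x0 [::]); split=> //.
  - apply: H0'; apply: runs_andthen_true H1 _; apply: runs_andthen_false.
    by apply: Hne; rewrite Hs0.
  - by move=> _; rewrite -Er1; apply: fin0.
  - move=> z /uniq[Ers [k [_ Hz _ _ _]]] _; move: Hs0.
    by rewrite Ers size_nth_table // Hz.
have {}Hne := Hne true (esym Hs0).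
have [|||| b2 [z [H2 Hz Hcz Hsz Hb2]]] := @assign_columnsP n rs rest n_gt0 Hrs x0 [::].
- by rewrite -Ew.
- by [].
- by [].
- by [].
rewrite -Ew in H2.
have finz r' c' s' t' : exists r x y c s t,
    pack r' (fun p => x0 p - count_mem p z) (fun p => count_mem p z) c' s' t' =
      pack r x y c s t
    /\ forall p : good_move n, x p + y p = x0 p.
  exists r', (fun p => x0 p - count_mem p z), (fun p => count_mem p z), c', s', t'.
  by split=> // p; rewrite subnK.
have H012 F b e' : runs F w (scan_heads rs x0 z) b e' -> b2 ->
    runs (bind enter_rows (fun _ => andthen (seeks n (iota 1 (n + n)))
      (andthen has_column (andthen (assign_columns n) F)))) w
      (blank_heads x0) b e'.
  move=> H E; rewrite E in H2; apply: H0'; apply: runs_andthen_true H1 _.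
  by apply: runs_andthen_true Hne _; apply: runs_andthen_true H2 _.
case: b2 H2 Hb2 H012 => H2 /= Hb2 H012; last first.
  exists false, (scan_heads rs x0 z); split=> //.
  - apply: H0'; apply: runs_andthen_true H1 _; apply: runs_andthen_true Hne _.
    exact: runs_andthen_false H2.
  - by move=> _; apply: finz.
  (* The table is that of [z'], hence well formed, so the scan failed at a good of a class [k']
     whose budget was spent. Then [z] and [z'] have equally many goods of class [k']; but the
     classes of [z'] start with those of [z] followed by [k']. *)
  move=> z' /uniq[Ers [k [_ Hz' _ _ _]]] Ex0; exfalso.
  have Hle : size z <= size z' by have := Hsz 0 n2_gt0; rewrite Ers size_nth_table.
  have d0 : good_move n by case: (z') Hz'.
  have Hcol g : g < size z' -> column n rs g = Some (Some (nth d0 z' g).1).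
    by rewrite Ers; apply: column_table.
  move: Hle; rewrite leq_eqVlt => /predU1P[Esz|Hlt].
    by case: Hb2 => [|[k' [+ _]]]; rewrite Esz Ers column_table_end.
  case: Hb2 => [|[k' [+ Hj]]]; rewrite Hcol // => -[Ek].
  have Efst : [seq p.1 | p : good_move n <- z] =
      [seq p.1 | p : good_move n <- take (size z) z'].
    apply: (@inj_map _ _ (Some \o Some)); first by move=> ? ? [].
    rewrite -map_comp Hz; apply: (@eq_from_nth _ None).
      by rewrite !size_map size_iota size_takel // ltnW.
    move=> g; rewrite size_map size_iota => Hg.
    rewrite (nth_map 0) ?size_iota // nth_iota // add0n Hcol; last exact: ltn_trans Hlt.
    rewrite -map_comp (nth_map d0) ?size_takel ?(ltnW Hlt) //= nth_take //.
  have : count (fun p : good_move n => p.1 == k') z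
       = count (fun p : good_move n => p.1 == k') z'.
    by rewrite !count_class; apply: eq_bigr => j _; rewrite Hj Ex0.
  rewrite -(cat_take_drop (size z) z') (drop_nth d0) // count_cat /= Ek eqxx.
  have Ecnt s : count (fun p : good_move n => p.1 == k') s
      = count_mem k' [seq p.1 | p : good_move n <- s] by rewrite count_map.
  by rewrite !Ecnt Efst -[LHS]addn0 => /addnI.
have Ers : rs = table z by apply: tableP.
have Hsz0 : 0 < size z by rewrite -(size_nth_table z n2_gt0) -Ers.
(* The run so far, closed by a trivial program, already bounds the counters. *)
have Hbd : forall v, scan_heads rs x0 z v <= (size w).+1.
  have Hb0 : forall v, blank_heads x0 v <= (size w).+1 by case=> [[[[i|i]|i]|i]|[]] /=.
  have := reach_bounded (H012 (ret true) _ _ (runs_ret _ _ _) isT) Hb0.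
  exact.
(* Both words are as long as the table, and no letter is more frequent in [z] than its budget, which
   is its count in [z']. So they are permutations of each other, with the same [gain] and [cost]. *)
have Hperm z' : solution w z' -> (forall p, x0 p = count_mem p z') -> perm_eq z z'.
  move=> /uniq[Ers' _] Ex0.
  have Esz : size z' = size z.
    by rewrite -(size_nth_table z' n2_gt0) -Ers' Ers size_nth_table.
  have [s Hs1 Hs2] : exists2 s, subseq s z' & perm_eq z s.
    by apply/count_subseqP => p; rewrite -Ex0.
  suff <- : s = z' by [].
  by apply/eqP; rewrite -(size_subseq_leqif Hs1) -(perm_size Hs2) Esz.
have Hgain : forall a, gain z a <= (size w).+1 by move=> a; apply: (Hbd (ch a)).
have [c' H3] := @runs_check_ef1 n w
  (fun i => if i < n + n then row_pos rs i + size z else row_pos rs i)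
  (fun p => x0 p - count_mem p z) (fun p => count_mem p z) (gain z) (cost z) 0
  Hgain.
rewrite -/(fair z) in H3.
case Hf: (fair z) H3 => H3; last first.
  exists false; eexists; split=> //.
  - by apply: H012 => //; apply: runs_andthen_false H3.
  - by move=> _; apply: finz.
  - move=> z' Hz' Ex0; have Hp := Hperm _ Hz' Ex0.
    move: Hz' => /uniq[_ [k [_ _ _ Hf' _]]].
    rewrite -Hf; apply/forallP=> a; rewrite /gain !(permP Hp).
    exact: (forallP Hf' a).
have [u Eu] : exists u, flatten [seq row l | l <- rs] = rcons u None.
  case/lastP: (rs) Hrs n2_gt0 => [<- //|rs' b _ _].
  exists (flatten [seq row l | l <- rs'] ++ [seq Some d | d <- b]).
  by rewrite map_rcons -cats1 flatten_cat /= cats0 /row -rcons_cat.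
have Ew2 : w = u ++ None :: rest by rewrite Ew Eu cat_rcons.
have [||b [r2 [s2 [H4 Hb]]]] := @runs_check_cost n w u rest
  (fun i => if i < n + n then row_pos rs i + size z else row_pos rs i)
    (fun p => x0 p - count_mem p z) (fun p => count_mem p z) c' (cost z) Ew2.
- exact: (Hbd (sh n)).
- by rewrite inordK // ltnn /row_pos -Hrs take_size Eu size_rcons.
exists b; eexists; split.
- by apply: H012 => //; apply: runs_andthen_true H3 H4.
- by move=> _; apply: finz.
- move=> /Hb[k [Ek Hk Hcost]]; exists z, k; rewrite -Ek -Ers.
  by split.
- move=> z' Hz' Ex0; have Hp := Hperm _ Hz' Ex0.
    move: Hz' => /uniq[_ [k [Ek _ Hk _ Hcost]]].
  by apply/Hb; exists k; split=> //; rewrite /cost (permP Hp).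
Qed.

Definition attempt_clean : prog bool :=
  bind attempt (fun ok => if ok then ret true else clean n).

(** Nested loops, one per head in [l]: each tries all positions up to the final blank and is rewound
    before the enclosing loop advances. A success is passed out through all loops. *)
Fixpoint enumerate (body : prog bool) (l : seq (good_move n)) : prog bool :=
  if l is p :: l' then
    bind (loop (bind (enumerate body l') (fun ok =>
            if ok then ret (Some true) else act (fun g =>
              if g (xh p) == None then (Some false, @stand n)
              else (None, pack still (fun q => if q == p then MoveRight else Stay)
                            still still Stay Stay)))))
         (fun ok => if ok then ret true else loop (act (fun g =>
              if g (xh p) == lmark symbol then (Some false, @stand n)
              else (None, pack still (fun q => if q == p then MoveLeft else Stay)
                            still still Stay Stay))))
  else body.

Lemma runs_attempt_clean w x0 : (forall p, x0 p <= (size w).+1) ->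
  exists b e', [/\ runs attempt_clean w (blank_heads x0) b e',
    b = false -> e' = blank_heads x0,
    b -> exists z, solution w z
    & forall z, solution w z -> (forall p, x0 p = count_mem p z) -> b].
Proof.
move=> Hx0; have [b [e' [H1 H2 H3 H4]]] := runs_attempt Hx0.
case: b H1 H2 H3 H4 => H1 H2 H3 H4.
  exists true, e'; split=> //; apply: runs_bind H1 _; exact: runs_ret.
have [r [x [y [c [s [t [Ee Exy]]]]]]] := H2 erefl.
have He' : forall v, e' v <= (size w).+1.
  by apply: reach_bounded H1 _; case=> [[[[i|i]|i]|i]|[]] /=.
exists false, (blank_heads x0); split=> //; apply: runs_bind H1 _.
have -> : x0 = (fun p => x p + y p) by apply: funext.
rewrite Ee; apply: runs_clean.
- by move=> i; have := He' (inl (inl (inl (inl i)))); rewrite Ee.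
- by move=> p; rewrite Exy.
- by move=> a; have := He' (ch a); rewrite Ee.
- by have := He' (sh n); rewrite Ee.
- by have := He' (th n); rewrite Ee.
Qed.

Section Enumeration.
Variables (w : seq symbol) (body : prog bool) (P : Prop).
Variable hit : (good_move n -> nat) -> Prop.
Hypothesis body_runs : forall x, (forall p, x p <= (size w).+1) ->
  exists b e', [/\ runs body w (blank_heads x) b e',
    b = false -> e' = blank_heads x, b -> P & hit x -> b].

(** Completeness ranges over the guesses that agree with [x] outside [l]: inner loops see the outer
    heads as fixed, and the induction on [l] frees them one at a time. *)
Lemma runs_enumerate l x : (forall p, x p <= (size w).+1) -> uniq l ->
  (forall p, p \in l -> x p = 0) ->
  exists b e', [/\ runs (enumerate body l) w (blank_heads x) b e',
    b = false -> e' = blank_heads x, b -> P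
    & forall x', (forall p, x' p <= (size w).+1) ->
        (forall p, p \notin l -> x' p = x p) -> hit x' -> b].
Proof.
elim: l x => [|p l IH] x Hx Hl Hx0.
  have [b [e' [H1 H2 H3 H4]]] := body_runs Hx; exists b, e'; split=> // x' _ Ex.
  by rewrite (_ : x' = x) //; apply: funext => q; apply: Ex.
move: Hl => /= /andP[Hp Hl].
pose upd i q := if q == p then i else x q.
pose F := bind (enumerate body l) (fun ok =>
            if ok then ret (Some true) else act (fun g =>
              if g (xh p) == None then (Some false, @stand n)
              else (None, pack still (fun q => if q == p then MoveRight else Stay)
                            still still Stay Stay))).
have round i : i <= (size w).+1 ->
    exists b e', [/\ runs (enumerate body l) w (blank_heads (upd i)) b e',
    b = false -> e' = blank_heads (upd i), b -> P
    & forall x', (forall q, x' q <= (size w).+1) ->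
        (forall q, q \notin p :: l -> x' q = x q) -> x' p = i -> hit x' -> b].
  move=> Hi; have [||q Hq|b [e' [H1 H2 H3 H4]]] := IH (upd i).
  - by move=> q; rewrite /upd; case: ifP.
  - by [].
  - rewrite /upd; case: eqP => [Eq|_]; first by rewrite Eq (negbTE Hp) in Hq.
    by rewrite Hx0 // inE Hq orbT.
  exists b, e'; split=> // x' Hx' Eq Hip; apply: H4 => // q Hq; rewrite /upd.
  by case: eqP => [->|/eqP Hqp] //; apply: Eq; rewrite inE negb_or Hqp.
(* Induction on the number of positions still to be tried for head [p]. *)
have rounds i : i <= (size w).+1 ->
    exists b e', [/\ runs (loop F) w (blank_heads (upd i)) b e',
    b = false -> e' = blank_heads (upd (size w).+1), b -> P
    & forall x', (forall q, x' q <= (size w).+1) ->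
        (forall q, q \notin p :: l -> x' q = x q) -> i <= x' p -> hit x' -> b].
  move Ed: ((size w).+1 - i) => m; elim: m i Ed => [|m IHm] i Ed Hi.
    have Ei : i = (size w).+1 by lia.
    have [b [e' [H1 H2 H3 H4]]] := round i Hi.
    exists b, e'; split=> //; last 1 first.
    + move=> x' Hx' Eq Hip; apply: H4 => //.
      by apply/eqP; rewrite eqn_leq Hip Ei Hx'.
    + apply: runs_loop_exit; apply: runs_bind H1 _.
      case: b H2 {H3 H4} => [_|/(_ erefl) ->]; first exact: runs_ret.
      by apply: runs_pack_still; rewrite /= /upd eqxx Ei rd_end.
    + by rewrite -Ei.
  have [b [e' [H1 H2 H3 H4]]] := round i Hi.
  case: b H1 H2 H3 H4 => H1 H2 H3 H4.
    exists true, e'; split=> //.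
    apply: runs_loop_exit; apply: runs_bind H1 _; exact: runs_ret.
  have [||b [e2 [H5 H6 H7 H8]]] := IHm i.+1; [lia | lia |].
  exists b, e2; split=> //; last first.
    move=> x' Hx' Eq; rewrite leq_eqVlt => /predU1P[Ei|Hlt] Hhit; last exact: (H8 x').
    by have := H4 x' Hx' Eq (esym Ei) Hhit.
  apply: runs_loop_next H5; apply: runs_bind H1 _; rewrite H2 //.
  have Hlt : i < (size w).+1 by lia.
  apply: runs_pack; [by rewrite /= rd_endE /upd eqxx // (ltn_eqF Hlt); reflexivity
    | by [] | move=> q /= | by [] ..].
  rewrite /upd; case: eqP => // _; rewrite mv_right //; lia.
have [//|b [e' [H1 H2 H3 H4]]] := rounds 0.
have Eupd : upd 0 = x.
  by apply: funext => q; rewrite /upd; case: eqP => // ->; rewrite Hx0 ?mem_head.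
rewrite Eupd in H1; case: b H1 H2 H3 H4 => H1 H2 H3 H4.
  exists true, e'; split=> //; apply: runs_bind H1 _; exact: runs_ret.
exists false, (blank_heads x); split=> //; last by move=> x' Hx' Eq; apply: (H4 x').
apply: runs_bind H1 _; rewrite H2 // -Eupd.
(* Rewinding head [p], generalised to an arbitrary starting position. *)
have [m Hm] : exists m, (size w).+1 = m by exists (size w).+1.
have Hm' : m <= (size w).+1 by rewrite Hm.
rewrite Hm; elim: m {Hm} Hm' => [|m IHm] Hm.
  by apply: runs_loop_exit; apply: runs_pack_still; rewrite /= /upd eqxx.
apply: runs_loop_next (IHm (ltnW Hm)).
apply: runs_pack; [by rewrite /= rd_lmark /upd eqxx //; reflexivity
  | by [] | move=> q /= | by [] ..].
by rewrite /upd; case: eqP.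
Qed.

End Enumeration.

(** Each row is as long as [z], so every letter count lies in the range of a head. *)
Lemma solution_size w z : solution w z -> size z <= size w.
Proof.
move=> [k [-> _ _ _ _]]; have n2_gt0 : 0 < n + n by lia.
have := @row_pos_lt n (table z) [seq Some d | d <- k] n_gt0 (size_table z)
  _ _ n2_gt0 (leqnn _).
by rewrite size_nth_table //; apply: leq_trans; apply: leq_addl.
Qed.

Lemma decide_solution w : exists b e',
  runs (enumerate attempt_clean (enum (good_move n))) w (fun=> 0) b e' /\
  (b <-> exists z, solution w z).
Proof.
pose hit (x : good_move n -> nat) :=
  exists2 z, solution w z & forall p, x p = count_mem p z.
have Hbody x : (forall p, x p <= (size w).+1) ->
    exists b e', [/\ runs attempt_clean w (blank_heads x) b e',
    b = false -> e' = blank_heads x, b -> (exists z, solution w z) & hit x -> b].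
  move=> /runs_attempt_clean[b [e' [H1 H2 H3 H4]]].
  by exists b, e'; split=> // -[z]; apply: H4.
have [||p _|b [e' [H1 _ H3 H4]]] :=
  runs_enumerate Hbody (l := enum (good_move n)) (x := fun=> 0).
- by [].
- exact: enum_uniq.
- by [].
have E0 : @blank_heads n (fun=> 0) = fun=> 0.
  by apply: funext => -[[[[i|i]|i]|i]|[]].
rewrite E0 in H1; exists b, e'; split=> //; split=> // -[z Hz].
apply: (H4 (fun p => count_mem p z)); last by exists z.
  by move=> p; apply: leqW; apply: leq_trans (count_size _ _) (solution_size Hz).
by move=> p; rewrite mem_enum.
Qed.

End Decider.

(** * Solutions and optimal transfers *)

Lemma binary_rec k : 1 < k -> binary k = rcons (binary k./2) (odd k).
Proof.
move=> Hk; rewrite /binary (trunc_log2S Hk) -[(trunc_log 2 k./2).+2]add1n iotaD.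
rewrite rev_cat map_cat (addnC 0 1) iotaDl -map_rev -map_comp.
rewrite [map _ (rev (iota 0 1))]/= divn1 cats1.
congr rcons; apply: eq_map => i /=.
by rewrite add1n expnS divnMA divn2.
Qed.

Lemma kval_binary k : kval (binary k) = k.
Proof.
elim/ltn_ind: k => k IH; case: (ltnP 1 k) => [Hk|]; last by case: k {IH} => [|[]].
by rewrite binary_rec // kval_rcons IH; lia.
Qed.

Lemma binary_head k : 0 < k -> exists b, binary k = true :: b.
Proof.
elim/ltn_ind: k => k IH Hk; case: (ltnP 1 k) => [Hk1|Hk1].
  have [|//|b Eb] := IH k./2; [lia | lia |].
  by exists (rcons b (odd k)); rewrite binary_rec // Eb.
have -> : k = 1 by lia.
by exists [::].
Qed.

Lemma canonical_binary k : canonical_digits [seq Some d | d <- binary k].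
Proof.
case: (posnP k) => [-> //|/binary_head[b ->]] /=.
by elim: b.
Qed.

(** With [kval_binary] and [canonical_binary], numbers and canonical digit strings correspond one to
    one. *)
Lemma binary_kval b : canonical_digits [seq Some d | d <- b] -> binary (kval b) = b.
Proof.
case: b => [//|[|] b] /= => [_|]; last by case: b.
have pos c : 0 < kval (true :: c).
  elim/last_ind: c => [//|c d IH]; rewrite -rcons_cons kval_rcons; lia.
elim/last_ind: b => [//|b d IH]; rewrite -rcons_cons kval_rcons binary_rec.
  by rewrite (_ : _./2 = kval (true :: b)) ?IH; [congr rcons|]; case: d; lia.
by have := pos b; lia.
Qed.

(** * Transfers as Hamming distance, EF1 as counting *)

Section Transfers.
Variables (R : realType) (I : instance R).
Implicit Types (f h : 'I_(goods I) -> 'I_(agents I)) (A B : bundles I).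

Definition owned f : bundles I := [ffun i => [set g | f g == i]].

Lemma owned_allocation f : is_allocation (owned f).
Proof.
split=> [i j Hij|].
  rewrite !ffunE -setI_eq0; apply/eqP/setP => g; rewrite !inE.
  by case: eqP => // ->; rewrite (negbTE Hij).
by apply/setP=> g; rewrite inE; apply/bigcupP; exists (f g); rewrite // ffunE inE.
Qed.

Lemma allocation_owned A : is_allocation A -> exists f, A = owned f.
Proof.
move=> [Hd Hc].
have Hex g : exists i, g \in A i.
  have : g \in (\bigcup_i A i)%SET by rewrite Hc inE.
  by case/bigcupP=> i _; exists i.
exists (fun g => xchoose (Hex g)); apply/ffunP=> i; rewrite ffunE.
apply/setP=> g; rewrite inE; apply/idP/eqP => [Hg|<-]; last exact: (xchooseP (Hex g)).
apply/eqP; apply: contraT => /Hd; rewrite -setI_eq0 => /eqP/setP/(_ g).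
by rewrite !inE Hg (xchooseP (Hex g)).
Qed.

Definition reassign f g j : 'I_(goods I) -> 'I_(agents I) :=
  fun g' => if g' == g then j else f g'.

Lemma transferP f B : transfer (owned f) B <->
  exists g j, f g != j /\ B = owned (reassign f g j).
Proof.
have E i j g : i != j -> f g = i ->
   [ffun h => if h == i then owned f i :\ g
              else if h == j then g |: owned f j else owned f h]
   = owned (reassign f g j).
  move=> Hij Hg; apply/ffunP=> h; rewrite !ffunE; apply/setP=> g'.
  rewrite [RHS]inE /reassign; case: (eqVneq g' g) => [->|Hg'].
    case: (eqVneq h i) => [->|Hhi]; first
      by rewrite !inE eqxx [j == _]eq_sym (negbTE Hij).
    case: (eqVneq h j) => [_|Hhj]; first by rewrite !inE eqxx.
    by rewrite inE Hg [i == _]eq_sym (negbTE Hhi).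
  case: (eqVneq h i) => [->|Hhi]; first by rewrite !inE Hg'.
  by case: (eqVneq h j) => [->|Hhj]; rewrite !inE // (negbTE Hg').
split=> [[i [j [g [Hij Hg ->]]]]|[g [j [Hj ->]]]].
  have {}Hg : f g = i by move: Hg; rewrite ffunE inE => /eqP.
  by exists g, j; split; [rewrite Hg | rewrite -(E i)].
by exists (f g), j, g; rewrite -(E (f g)) //; split=> //; rewrite ffunE inE.
Qed.

Definition moved f h : nat := #|[pred g | h g != f g]|.

(** A transfer changes a single value of the owner function, so it moves the distance by at most
    one. *)
Lemma reachable_moved T f B : reachable_in T (owned f) B ->
  exists2 h, B = owned h & moved f h <= T.
Proof.
elim: T f => [|T IH] f /=.
  by move=> <-; exists f => //; rewrite leqn0 /moved; apply/eqP/eq_card0=> g;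
    rewrite inE eqxx.
case=> C /transferP[g [j [Hj ->]]] /IH[h -> Hh]; exists h => //.
rewrite -add1n; apply: leq_trans (leq_add (leqnn 1) Hh).
rewrite /moved (cardD1 g) leq_add ?leq_b1 //.
apply/subset_leq_card/subsetP=> g'; rewrite !inE /reassign.
by case: eqP => // _ /andP[].
Qed.

(** Send each misplaced good directly to its final owner. *)
Lemma reachable_owned f h : reachable_in (moved f h) (owned f) (owned h).
Proof.
move Em: (moved f h) => m; elim: m f Em => [|m IH] f Em /=.
  congr owned; apply: funext => g; apply/eqP; rewrite eq_sym; apply: contraT => Hg.
  by have := card0_eq Em g; rewrite inE Hg.
have [g Hg] : exists g, h g != f g.
  have /card_gt0P[g] : 0 < moved f h by rewrite Em.
  by rewrite inE; exists g.
exists (owned (reassign f g (h g))).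
  by apply/transferP; exists g, (h g); rewrite eq_sym.
apply: IH; move: Em; rewrite /moved (cardD1 g) inE Hg => -[<-].
apply: eq_card => g'; rewrite !inE /reassign.
by case: (eqVneq g' g) => [->|_] //=; rewrite eqxx.
Qed.

Lemma optimal_transfersP f k : optimal_transfers (owned f) k <->
  exists2 h, EF1 (owned h) & moved f h <= k.
Proof.
split=> [[T [[B HB HE] _] HT]|[h Hh Hk]].
  have [h EB Hm] := reachable_moved HB; exists h; first by rewrite -EB.
  exact: leq_trans HT.
have Hex : exists T, `[< EF1_reachable_in (owned f) T >].
  by exists (moved f h); apply/asboolP; exists (owned h) => //; apply: reachable_owned.
case: (ex_minnP Hex) => T /asboolP HT Hmin; exists T.
  by split=> // T' HT'; apply: Hmin; apply/asboolP.
apply: leq_trans Hk; apply: Hmin; apply/asboolP; exists (owned h) => //.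
exact: reachable_owned.
Qed.

Hypothesis bin : binary_utilities I.

Definition likes (i : 'I_(agents I)) (g : 'I_(goods I)) : bool :=
  util i [set g] == 1%R.

Lemma util_card i (S : {set 'I_(goods I)}) :
  util i S = (#|[pred g in S | likes i g]|%:R)%R.
Proof.
rewrite util_additive -sum1_card natr_sum /= big_mkcondr /=.
apply: eq_bigr => g _; rewrite /likes; case: (bin i g) => ->.
  by rewrite eq_sym oner_eq0.
by rewrite eqxx.
Qed.

(** Removing a good that [i] likes lowers u_i(A_j) by exactly one. If [i] likes nothing in A_j, then
    A_j is empty or loses any good and still has value 0. *)
Lemma EF1_ownedP h : EF1 (owned h) <->
  forall i j, #|[pred g | likes i g && (h g == j)]| <=
              #|[pred g | likes i g && (h g == i)]|.+1.
Proof.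
have Ecard i j : #|[pred g in owned h j | likes i g]|
    = #|[pred g | likes i g && (h g == j)]|.
  by apply: eq_card => g; rewrite !inE ffunE inE andbC.
have EcardD i j g0 : #|[pred g in owned h j :\ g0 | likes i g]|
    = #|[predD1 [pred g | likes i g && (h g == j)] & g0]|.
  by apply: eq_card => g; rewrite !inE ffunE inE -andbA; congr andb; rewrite andbC.
split=> [H i j|H i j Hij].
  case: (eqVneq i j) => [->|/H[E|[g Hg]]]; first exact: leqnSn.
    rewrite -Ecard E (_ : #|_| = 0) //; apply: eq_card0 => g.
    by rewrite !inE.
  rewrite !util_card ler_nat EcardD Ecard => Hle.
  by rewrite (cardD1 g) -add1n leq_add // leq_b1.
case: (pickP [pred g | likes i g && (h g == j)]) => [g /= Hg|H0].
  right; exists g; first by rewrite ffunE inE; case/andP: Hg.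
  rewrite !util_card ler_nat EcardD Ecard.
  by have := H i j; rewrite (cardD1 g) inE Hg add1n ltnS.
case: (pickP (fun g => g \in owned h j)) => [g Hg|H1].
  right; exists g => //; rewrite !util_card ler_nat EcardD eq_card0 // => g'.
  by have := H0 g'; rewrite !inE => ->; rewrite andbF.
by left; apply/setP=> g; rewrite H1 inE.
Qed.

Definition profile f h : seq (good_move (agents I)) :=
  [seq (([ffun i => likes i g], f g), h g) | g <- enum 'I_(goods I)].

Lemma count_profile f h (P : pred (good_move (agents I))) :
  count P (profile f h) = #|[pred g | P (([ffun i => likes i g], f g), h g)]|.
Proof.
rewrite count_map -sum1_count -sum1_card big_mkcond big_enum -big_mkcond.
exact: eq_bigl.
Qed.

Lemma gain_profile f h i j :
  gain (profile f h) (i, j) = #|[pred g | likes i g && (h g == j)]|.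
Proof.
rewrite /gain count_profile; apply: eq_card => g.
by rewrite !inE /= ffunE eq_sym.
Qed.

Lemma fair_profile f h : fair (profile f h) <-> EF1 (owned h).
Proof.
rewrite EF1_ownedP; split=> [/forallP H i j|H].
  by have := H (i, j); rewrite !gain_profile.
by apply/forallP=> -[i j]; rewrite !gain_profile.
Qed.

Lemma cost_profile f h : cost (profile f h) = moved f h.
Proof. by rewrite /cost count_profile. Qed.

(** The input does not depend on the target, so the same table serves for every [h]. *)
Lemma encode_owned f h k : encode (owned f) k =
  flatten [seq row l | l <- table (profile f h)] ++ [seq Some d | d <- binary k].
Proof.
rewrite /encode catA; congr cat; rewrite /table map_cat flatten_cat.
congr cat; congr flatten; rewrite -[RHS]map_comp; apply: eq_map => i /=; congr row;
  rewrite -[RHS]map_comp; apply: eq_map => g /=.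
  by rewrite ffunE.
by rewrite ffunE inE eq_sym.
Qed.

End Transfers.

Lemma optimal_solution (R : realType) (I : instance R) (A : bundles I) k :
  binary_utilities I -> is_allocation A -> optimal_transfers A k ->
  exists z, solution (n := agents I) (encode A k) z.
Proof.
move=> bin /allocation_owned[f ->] /optimal_transfersP[h Hh Hk].
exists (profile f h), (binary k); split.
- exact: encode_owned.
- by rewrite size_map size_enum_ord; apply: goods_ge1.
- exact: canonical_binary.
- by apply/fair_profile.
- by rewrite cost_profile kval_binary.
Qed.

(** * From a certificate back to an instance *)

Section FromSolution.
Variables (R : realType) (n : nat) (hn : 2 <= n) (z : seq (good_move n)).
Hypothesis z_gt0 : 0 < size z.

Let move_of (g : 'I_(size z)) : good_move n := tnth (in_tuple z) g.

Definition sol_util (i : 'I_n) (S : {set 'I_(size z)}) : R :=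
  (\sum_(g in S) ((move_of g).1.1 i)%:R)%R.

Lemma sol_util_ge0 i S : (0 <= sol_util i S)%R.
Proof. by apply: sumr_ge0 => g _; rewrite ler0n. Qed.

Lemma sol_util1 i g : sol_util i [set g] = ((move_of g).1.1 i)%:R%R.
Proof. by rewrite /sol_util big_set1. Qed.

Lemma sol_util_additive i S :
  sol_util i S = (\sum_(g in S) sol_util i [set g])%R.
Proof. by apply: eq_bigr => g _; rewrite sol_util1. Qed.

Definition sol_instance : instance R :=
  Instance hn z_gt0 sol_util_ge0 sol_util_additive.

Lemma sol_binary : binary_utilities sol_instance.
Proof.
by move=> i g; rewrite [util _ _]sol_util1; case: ((move_of g).1.1 i); [right | left].
Qed.

Lemma sol_profile : profile (I := sol_instance) (fun g => (move_of g).1.2)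
  (fun g => (move_of g).2) = z.
Proof.
rewrite -[RHS](map_tnth_enum (in_tuple z)) /profile; apply: eq_map => g.
rewrite -/(move_of g) [RHS]surjective_pairing; congr pair.
rewrite [RHS]surjective_pairing; congr pair; apply/ffunP=> i.
by rewrite ffunE /likes [util _ _]sol_util1; case: ((move_of g).1.1 i);
  rewrite ?eqxx // eq_sym oner_eq0.
Qed.

End FromSolution.

(** A certificate holds all the data of an instance and a target: every nonempty [z] is the profile
    of the instance built from it. *)
Lemma solutionP (R : realType) n (hn : 2 <= n) w :
  (exists z, solution (n := n) w z) <-> binary_optimal_transfers R n w.
Proof.
split=> [[z [k [Ew z_gt0 Hk Hf Hc]]]|[I [A [k [[En bin] HA -> Hopt]]]]]; last first.
  by have := optimal_solution bin HA Hopt; rewrite En.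
pose I := sol_instance R hn z_gt0.
pose f (g : 'I_(goods I)) : 'I_(agents I) := (tnth (in_tuple z) g).1.2.
pose h (g : 'I_(goods I)) : 'I_(agents I) := (tnth (in_tuple z) g).2.
have Ez : profile (I := I) f h = z := sol_profile R hn z_gt0.
have bin : binary_utilities I by apply: sol_binary.
exists I, (owned f), (kval k); split=> //.
- exact: owned_allocation.
- by rewrite Ew (encode_owned f h) Ez binary_kval.
apply/optimal_transfersP; exists h.
  by apply/(fair_profile bin f); rewrite Ez.
by rewrite -(cost_profile f h) Ez.
Qed.

Theorem theoremC4 (R : realType) (n : nat) (hn : (2 <= n)%N) :
  in_P (binary_optimal_transfers R n).
Proof.
have n_gt0 : 0 < n by apply: ltnW.
apply: (in_P_frag (F := enumerate (attempt_clean n) (enum (good_move n)))) => w.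
have [b [e' [H1 H2]]] := decide_solution n_gt0 w.
exists b, e'; split=> //.
by split=> [/H2/(solutionP R hn)|/(solutionP R hn)/H2].
Qed.
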